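(* Let $C\ge1$, let $\mathcal{S}_1,\dots,\mathcal{S}_C$ be Polish spaces, and let $(X_{n,i})_{n\ge1,\,1\le i\le C}$ be an infinite multi-exchangeable system, $X_{n,i}$ having state space $\mathcal{S}_i$, with directing measure vector $(\Lambda_i)_{1\le i\le C}$. Let $\mathcal{E}$ be its multi-exchangeable $\sigma$-algebra and $\mathcal{T}$ its multi-tail $\sigma$-algebra. Then $$\sigma\bigl((\Lambda_i)_{1\le i\le C}\bigr)=\mathcal{T}=\mathcal{E}\quad\text{a.s.}$$ If moreover the random variables $X_{n,i}$, $n\ge1$, $1\le i\le C$, are independent, then $\mathbf{P}(A)\in\{0,1\}$ for all $A\in\mathcal{E}$.
   Context: The system $(X_{n,i})_{n\ge1,\,1\le i\le C}$ is defined on a probability space with probability $\mathbf{P}$; $\mathcal{L}$ denotes the law of a random element. For a Polish space $\mathcal{S}$, $\mathcal{P}(\mathcal{S})$ is the space of Borel probability measures on $\mathcal{S}$ with the weak topology. The system $(X_{n,i})_{n\ge1,\,1\le i\le C}$ is multi-exchangeable if every finite sub-system $(X_{n,i})_{1\le n\le N_i,\,1\le i\le C}$ is multi-exchangeable, i.e. has the same law as $(X_{\sigma_i(n),i})_{1\le n\le N_i,\,1\le i\le C}$ for all permutations $\sigma_i$ of $\{1,\dots,N_i\}$, $1\le i\le C$. Then each sequence $(X_{n,i})_{n\ge1}$ is infinite exchangeable and has a directing measure, the random element of $\mathcal{P}(\mathcal{S}_i)$ given by the almost sure weak limit $\Lambda_i=\lim_{N\to\infty}\frac1N\sum_{n=1}^N\delta_{X_{n,i}}$;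 the vector $(\Lambda_i)_{1\le i\le C}$ is the directing measure vector. For $k\ge1$, a Borel set $B\subset\mathcal{S}_1^\infty\times\cdots\times\mathcal{S}_C^\infty$ is $k$-multi-exchangeable if for all permutations $\sigma_i$ of $\{1,2,\dots\}$ fixing every element of $\{k+1,k+2,\dots\}$, $1\le i\le C$, $$(x_{n,i})_{n\ge1,\,1\le i\le C}\in B\iff(x_{\sigma_i(n),i})_{n\ge1,\,1\le i\le C}\in B.$$ The multi-exchangeable $\sigma$-algebra is $$\mathcal{E}=\bigcap_{k\ge1}\mathcal{E}_k,\qquad\mathcal{E}_k=\bigl\{\{(X_{n,i})_{n\ge1,\,1\le i\le C}\in B\}: B\text{ is }k\text{-multi-exchangeable}\bigr\},$$ and the multi-tail $\sigma$-algebra is $$\mathcal{T}=\bigcap_{k\ge1}\mathcal{T}_k,\qquad\mathcal{T}_k=\sigma\bigl((X_{n,i})_{n\ge k,\,1\le i\le C}\bigr).$$ Equality of $\sigma$-algebras ''a.s.'' means equality up to $\mathbf{P}$-null sets: every event of either $\sigma$-algebra differs from some event of the other by a $\mathbf{P}$-null set. *)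

(* Defs.v *)
From HB Require Import structures.
From mathcomp Require Import all_boot all_order all_algebra perm finmap.
From mathcomp Require Import all_classical all_reals all_analysis.

Set Implicit Arguments.
Unset Strict Implicit.
Unset Printing Implicit Defensive.

Import Order.TTheory GRing.Theory Num.Theory.
Import numFieldNormedType.Exports.

Local Open Scope classical_set_scope.
Local Open Scope ring_scope.

Section polish.
Variables (R : realType) (T : topologicalType).

Definition separable_space := exists2 D : set T, countable D & dense D.

Definition is_metric (d : T -> T -> R) :=
  [/\ forall x y, 0 <= d x y,
      forall x y, d x y = 0 <-> x = y,
      forall x y, d x y = d y x
    & forall x y z, d x z <= d x y + d y z].

Definition metric_induces_topology (d : T -> T -> R) :=
  forall x : T, nbhs x =
    filter_from [set e : R | 0 < e] (fun e => [set y | d x y < e]).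

Definition complete_metric (d : T -> T -> R) :=
  forall u : nat -> T,
    (forall e : R, 0 < e -> exists N : nat, forall m n : nat,
       (N <= m)%N -> (N <= n)%N -> d (u m) (u n) < e) ->
    exists l : T, forall e : R, 0 < e -> exists N : nat, forall n : nat,
       (N <= n)%N -> d (u n) l < e.

Definition polish := separable_space /\
  exists d : T -> T -> R,
    [/\ is_metric d, metric_induces_topology d & complete_metric d].

End polish.

Definition borel (T : ptopologicalType) : measurableType (@open T).-sigma :=
  g_sigma_algebraType (@open T).

Section weak_topology.
Variables (R : realType) (T : ptopologicalType).

Definition bounded_continuous :=
  {f : T -> R | continuous f /\ bounded_fun f}.

Definition integrate (mu : probability (borel T) R) :
    prod_topology (fun _ : bounded_continuous => R) :=
  fun f => \int[mu]_x (sval f x).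

(* The elements are functions on all subsets of T, constrained only on the
   Borel ones; two of them that agree on Borel sets are topologically
   indistinguishable. *)
Definition prob_space : ptopologicalType := initial_topology integrate.

End weak_topology.

Section empirical.
Local Open Scope ereal_scope.
Variables (R : realType) (T : ptopologicalType) (x : nat -> T) (N : nat).

(* The number of atoms is N.+1, so that this is always a probability measure. *)
Definition empirical : set (borel T) -> \bar R :=
  mscale ((N.+1%:R : R)^-1%:nng)%R
    (msum (fun n : nat => (\d_(x n : borel T) : {measure set (borel T) -> \bar R}))
       N.+1).

HB.instance Definition _ := Measure.on empirical.

Let empirical_setT : empirical setT = 1.
Proof.
rewrite /empirical /mscale /= /msum.
rewrite (eq_bigr (fun=> 1)) => [|i _]; last exact: diracT.
by rewrite sumEFin sumr_const card_ord -EFinM mulVf.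
Qed.

HB.instance Definition _ :=
  Measure_isProbability.Build _ _ _ empirical empirical_setT.

Definition empirical_measure : prob_space R T := empirical : probability _ _.

End empirical.

Section sigma_algebras.
Variables (d : measure_display) (Omega : measurableType d) (R : realType)
  (P : probability Omega R).

Definition sigma_of (I : Type) (J : set I) (T : I -> ptopologicalType)
    (F : forall i, {RV P >-> borel (T i)}) : set (set Omega) :=
  <<s \bigcup_(j in J) preimage_set_system setT (F j) measurable >>.

Definition sigma_ae_eq (F G : set (set Omega)) :=
  (forall A, F A -> exists2 B, G B & P.-negligible (A `+` B)) /\
  (forall B, G B -> exists2 A, F A & P.-negligible (A `+` B)).

Definition mutually_independent (I : choiceType) (T : I -> ptopologicalType)
    (F : forall i, {RV P >-> borel (T i)}) :=
  forall (J : {fset I}) (B : forall i, set (borel (T i))),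
    (forall i, measurable (B i)) ->
    P (\bigcap_(i in [set` J]) F i @^-1` B i) =
    (\prod_(i <- J) P (F i @^-1` B i))%E.

Definition is_directing_measure (T : ptopologicalType)
    (X : nat -> {RV P >-> borel T}) (L : {RV P >-> borel (prob_space R T)}) :=
  {ae P, forall w,
    empirical_measure R (fun n => X n w : T) @ \oo --> (L w : prob_space R T)}.

End sigma_algebras.

HB.instance Definition _ (I : Type) (T : I -> ptopologicalType) :=
  Pointed.copy (prod_topology T) (forall i, T i).

Definition product_space (I : Type) (T : I -> ptopologicalType) :
  ptopologicalType := prod_topology T.

Section multi_exchangeability.
Variables (d : measure_display) (Omega : measurableType d) (R : realType)
  (P : probability Omega R) (C : nat) (S : 'I_C -> ptopologicalType).

Definition finite_system_space (N : 'I_C -> nat) : ptopologicalType :=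
  product_space (fun i : 'I_C => product_space (fun _ : 'I_(N i) => S i)).

Definition system_space : ptopologicalType :=
  product_space (fun i : 'I_C => product_space (fun _ : nat => S i)).

(* Indices n of sequences start at 0: X n i stands for X_{n+1,i}. *)
Variable X : nat -> forall i : 'I_C, {RV P >-> borel (S i)}.

Definition multi_exchangeable :=
  forall (N : 'I_C -> nat) (s : forall i : 'I_C, {perm 'I_(N i)}),
    forall B : set (borel (finite_system_space N)), measurable B ->
      pushforward P (fun w => (fun i n => X n i w) : borel (finite_system_space N)) B =
      pushforward P (fun w => (fun i n => X (s i n) i w) : borel (finite_system_space N)) B.

Definition system (w : Omega) : system_space := fun i n => X n i w.

Definition k_multi_exchangeable (k : nat) (B : set system_space) :=
  forall s : 'I_C -> nat -> nat,
    (forall i, bijective (s i)) ->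
    (forall i n, (k <= n)%N -> s i n = n) ->
    forall x : system_space, B x <-> B (fun i n => x i (s i n)).

Definition exch_sigma_k (k : nat) : set (set Omega) :=
  [set system @^-1` B | B in
     [set B : set (borel system_space) |
        measurable B /\ k_multi_exchangeable k B]].

Definition exch_sigma : set (set Omega) :=
  \bigcap_(k in [set k | (0 < k)%N]) exch_sigma_k k.

Definition tail_sigma_k (k : nat) : set (set Omega) :=
  sigma_of [set p : nat * 'I_C | (k <= p.1.+1)%N] (fun p => X p.1 p.2).

Definition tail_sigma : set (set Omega) :=
  \bigcap_(k in [set k | (0 < k)%N]) tail_sigma_k k.

End multi_exchangeability.

(* Main.v *)
Require Import Defs.
From HB Require Import structures.
From mathcomp Require Import finmap.
From mathcomp Require Import all_boot all_order all_algebra perm.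
From mathcomp Require Import all_classical all_reals all_analysis.
From mathcomp Require Import measurable_realfun.
From mathcomp Require Import ring lra.

Set Implicit Arguments.
Unset Strict Implicit.
Unset Printing Implicit Defensive.

Import Order.TTheory GRing.Theory Num.Theory.
Import numFieldNormedType.Exports.

Local Open Scope classical_set_scope.
Local Open Scope ring_scope.

(** The chain of inclusions, up to null sets, is
      sigma(Lambda) <= tail <= exchangeable <= sigma(Lambda).

    Tail events are exchangeable, with no null set involved, because a
    permutation of the first k rows does not touch the coordinates beyond k
    ([tail_sub_exch]).

    That sigma(Lambda) is almost surely contained in the tail sigma-algebra
    ([sigma_Lambda_tail]) combines two facts. For f bounded and continuous,
    the integral of f against Lambda_i is almost surely the limit of the
    empirical means of f, and this limit ignores finitely many terms. And the
    Borel sets of the space of probability measures are generated by countably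
    many such integrals: the state space carries a countable family of bump
    functions ([polish_bumps]); every nonnegative bounded continuous function
    is the increasing limit of finite maxima of rational multiples of bumps
    ([tent_approx]), so that the sets of measures giving such a maximum an
    integral above a rational number form a countable subbase of the weak
    topology ([weak_subbaseP]).

    The last inclusion ([exch_sub_sigma_Lambda]) is where exchangeability is
    used. Let A be exchangeable and let f be a function of the coordinate
    X_{n,i}. In the expectation of 1_A f(X_{n,i}) g, with g depending on finitely
    many other coordinates, X_{n,i} may be replaced by X_{m,i} for every
    large m, hence by an empirical mean, hence by the integral of f against
    Lambda_i. Replacing one coordinate after the other turns the expectation
    of 1_A times a product of functions of the coordinates into the
    expectation of 1_A times a sigma(Lambda)-measurable variable
    ([transp_invariant_product]). A pi-lambda argument over boxes
    ([Lambda_approx_box], [Lambda_approx_system]) then shows that for every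
    event D generated by the system and every e > 0 there is one bounded
    sigma(Lambda)-measurable phi for which the expectations of 1_A 1_D and
    1_A phi are e-close, uniformly over the events A that are exchangeable up
    to a null set. For D itself exchangeable, testing with A = D minus {phi > 1/2} and with
    A = {phi > 1/2} minus D bounds the probability of the symmetric difference
    of D and {phi > 1/2} by a multiple of e, and Borel-Cantelli concludes
    ([ae_in_approx]).

    When the coordinates are independent, an exchangeable event is almost
    surely a tail event, and a tail event is independent of every finite
    family of coordinates, hence of itself ([cylinder_independent],
    [independent_sigma_algebra]). *)

(** * Open sets of a space with a countable subbase *)

Section countable_subbase.
Variables (T : topologicalType) (I : countType) (B : I -> set T).

Definition finite_meet (s : seq I) : set T :=
  [set x | forall k, k \in s -> B k x].

Definition subbase_nbhs (x : T) : set_system T :=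
  [set N | exists2 s, finite_meet s x & finite_meet s `<=` N].

Lemma subbase_nbhs_filter x : Filter (subbase_nbhs x).
Proof.
split.
- by exists [::].
- move=> N M [s xs sN] [t xt tM]; exists (s ++ t).
    by move=> k; rewrite mem_cat => /orP[]; [exact: xs|exact: xt].
  move=> y yst; split; [apply: sN|apply: tM] => k kst; apply: yst;
    by rewrite mem_cat kst ?orbT.
- by move=> N M NM [s xs sN]; exists s => //; exact: subset_trans NM.
Qed.

Lemma subbase_nbhs_mem k x : B k x -> subbase_nbhs x (B k).
Proof.
move=> Bkx; exists [:: k] => [j|y]; first by rewrite inE => /eqP ->.
by apply; rewrite inE.
Qed.

(** The open set U is the union of the finite meets it contains, and there are
    only countably many of these. Stating this for preimages serves at once
    for the Borel sets of a space and for the measurability of maps into it. *)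
Lemma measurable_preimage_open d (aT : measurableType d) (f : aT -> T) :
  (forall x, subbase_nbhs x `=>` nbhs x) ->
  (forall k, measurable (f @^-1` B k)) ->
  forall U, open U -> measurable (f @^-1` U).
Proof.
move=> subB mB U oU.
have -> : f @^-1` U =
    \bigcup_(s in [set s : seq I | finite_meet s `<=` U]) f @^-1` finite_meet s.
  apply/seteqP; split => [w Uw|w [s sU]]; last exact: sU.
  have [|s sfw sU] := subB (f w) U; first by move: oU; rewrite openE; apply.
  by exists s.
rewrite bigcup_mkcond; apply: countable_bigcupT_measurable => [|s]; first exact: countableP.
case: ifPn => // _; elim: s => [|k s IH].
  by rewrite (_ : _ @^-1` _ = setT)//; apply/seteqP; split.
rewrite (_ : _ @^-1` _ = f @^-1` B k `&` f @^-1` finite_meet s).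
  exact: measurableI.
apply/seteqP; split => w /=.
  by move=> H; split; [apply: H; rewrite inE eqxx|
    move=> j js; apply: H; rewrite inE js orbT].
by move=> [Bk H] j; rewrite inE => /predU1P[->//|]; exact: H.
Qed.

End countable_subbase.

(** Integration against all bounded continuous functions is not surjective onto
    the product, so convergence is read off the basic open sets, which are
    preimages, rather than transported to images. *)
Lemma cvg_initial (S : choiceType) (T : topologicalType) (f : S -> T)
    (F : set_system S) (s : S) : Filter F ->
  f @ F --> f s -> F --> (s : initial_topology f).
Proof.
move=> FF cF A /= [_ [[B oB <-] /= Bfs] sBA].
apply: filterS sBA _; apply: (cF B).
by move: oB; rewrite openE; apply.
Qed.

Lemma cvg_prod (I : Type) (T : I -> topologicalType)
    (F : set_system (prod_topology T)) (x : prod_topology T) : Filter F ->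
  (forall i, (fun y : prod_topology T => y i) @ F --> x i) -> F --> x.
Proof.
move=> FF cF; apply/cvg_sup => i.
exact: (@cvg_initial (forall i, T i) (T i) (fun y => y i)).
Qed.

(** * Bump functions on a Polish space *)

(** This is the form in which the Polish hypothesis enters everywhere below.
    The value 1 at x matters for [tent_approx], where rational multiples of
    bumps must come close to the value of a given function at x; the supports
    are described by strict positivity so that they are open. *)
Definition bump_family (R : realType) (T : topologicalType) (b : nat -> T -> R) :=
  [/\ forall k, continuous (b k),
      forall k x, 0 <= b k x <= 1
    & forall (x : T) U, nbhs x U ->
        exists2 k, b k x = 1 & forall y, 0 < b k y -> U y].

Section bumps.
Variables (R : realType) (T : ptopologicalType).

Lemma dense_seq : separable_space T ->
  exists u : nat -> T, forall (x : T) U, nbhs x U -> exists n, U (u n).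
Proof.
move=> [D /countable_injP[g gI] dD].
exists (fun n => get [set y | D y /\ g y = n]) => x U xU.
have [||y [Uy Dy]] := dD (interior U); [by exists x| exact: open_interior|].
exists (g y).
have [/= Dz gz] := @getPex _ [set z | D z /\ g z = g y] (ex_intro _ y (conj Dy erefl)).
have -> := gI _ _ _ _ gz; rewrite ?inE//; exact: interior_subset.
Qed.

Lemma metric_continuous (d : T -> T -> R) : is_metric d ->
  metric_induces_topology d -> forall c, continuous (d ^~ c).
Proof.
move=> [d0 dE dC dT] dtop c x; apply/cvgrPdist_lt => e e0 /=.
have : nbhs x [set y | d x y < e] by rewrite dtop; exists e.
apply: filterS => y /= xy; rewrite ltr_norml.
have := dT x y c; have := dT y x c; rewrite (dC y x); lra.
Qed.

(** The bumps are radial functions around the points of a dense sequence, equal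
    to 1 on the ball of radius 1/(m+1) and vanishing outside the ball of
    radius 2/(m+1). *)
Lemma polish_bumps : polish R T -> exists b : nat -> T -> R, bump_family b.
Proof.
move=> [/dense_seq[u du] [d [dm dtop _]]].
have [d0 dE dC dT] := dm.
pose h (p : nat * nat) : T -> R :=
  (fun=> 1 : R^o) \min ((fun=> 0) \max (fun x => 2 - p.1.+1%:R * d x (u p.2))).
have hE p x : h p x = Num.min 1 (Num.max 0 (2 - p.1.+1%:R * d x (u p.2))) by [].
have hc p : continuous (h p).
  move=> x; apply: continuous_min; first exact: cvg_cst.
  apply: continuous_max; first exact: cvg_cst.
  apply: cvgB; first exact: cvg_cst.
  by apply: cvgM; [exact: cvg_cst|exact: metric_continuous].
have h01 p x : 0 <= h p x <= 1.
  by rewrite hE ge_min lexx le_min ler01 le_max lexx.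
exists (fun k => if unpickle k is Some p then h p else fun=> 0); split.
- by move=> k; case: unpickle => [p|]; [exact: hc|move=> x; exact: cvg_cst].
- by move=> k x; case: unpickle => [p|]; rewrite ?h01// lexx ler01.
move=> x U; rewrite dtop => -[e /= e0 eU].
(* If x is within 1/(m+1) of the centre and y within 2/(m+1), then y is within
   3/(m+1) < e of x. *)
pose m := Num.bound (3 / e).
have me : 3 / e < m.+1%:R.
  have := @archi_boundP R (3 / e).
  rewrite divr_ge0 ?ltW// => /(_ isT) /lt_le_trans; apply.
  by rewrite ler_nat.
have m0 : 0 < m.+1%:R :> R by rewrite ltr0n.
have [|n un] := du x [set y | d x y < m.+1%:R^-1].
  by rewrite dtop; exists m.+1%:R^-1; rewrite //= invr_gt0.
have {}un : m.+1%:R * d x (u n) < 1.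
  by rewrite -ltr_pdivlMl// mulr1.
exists (pickle (m, n)); rewrite pickleK.
  by rewrite hE; apply/min_idPl; rewrite le_max /=; apply/orP; right; lra.
move=> y; rewrite hE lt_min ltr01 lt_max ltxx /= => yn; apply: eU => /=.
rewrite ltr_pdivrMr// in me.
have := dT x (u n) y; rewrite (dC (u n)) => xy.
rewrite -(ltr_pM2l m0) (le_lt_trans (ler_wpM2l (ltW m0) xy))//.
by rewrite mulrDr; lra.
Qed.

End bumps.

(** * Expectations of bounded measurable functions *)

Lemma bounded_fun_norm_le (T : Type) (R : realType) (f : T -> R) M :
  (forall x, `|f x| <= M) -> bounded_fun f.
Proof.
move=> fM; exists M; split; first exact: num_real.
by move=> N MN x _; exact: le_trans (fM x) (ltW MN).
Qed.

Lemma bounded_fun_ex (T : Type) (R : realType) (f : T -> R) :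
  bounded_fun f -> exists M, forall x, `|f x| <= M.
Proof.
by move=> [M [_ fM]]; exists (M + 1) => x; apply: (fM _ _ x) => //; rewrite ltrDl.
Qed.

Section bounded_measurable.
Context d (T : measurableType d) (R : realType).
Implicit Types f g : T -> R.

Definition bmeas f := measurable_fun setT f /\ exists M, forall x, `|f x| <= M.

Lemma bmeas_cst r : bmeas (fun=> r).
Proof. by split; [exact: measurable_cst|exists `|r|]. Qed.

Lemma bmeasD f g : bmeas f -> bmeas g -> bmeas (fun x => f x + g x).
Proof.
move=> [mf [M fM]] [mg [N gN]]; split; first exact: measurable_funD.
by exists (M + N) => x; rewrite (le_trans (ler_normD _ _))// lerD.
Qed.

Lemma bmeasM f g : bmeas f -> bmeas g -> bmeas (fun x => f x * g x).
Proof.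
move=> [mf [M fM]] [mg [N gN]]; split; first exact: measurable_funM.
by exists (M * N) => x; rewrite normrM ler_pM.
Qed.

Lemma bmeasB f g : bmeas f -> bmeas g -> bmeas (fun x => f x - g x).
Proof.
move=> bf bg; rewrite (_ : (fun _ => _) = (fun x => f x + -1 * g x)).
  exact/bmeasD/bmeasM/bg/bmeas_cst.
by apply/funext => x; rewrite mulN1r.
Qed.

Lemma bmeas_norm f : bmeas f -> bmeas (fun x => `|f x|).
Proof.
move=> [mf [M fM]]; split; first exact: measurableT_comp.
by exists M => x; rewrite normr_id.
Qed.

Lemma bmeas_sum (I : Type) (s : seq I) (F : I -> T -> R) :
  (forall i, bmeas (F i)) -> bmeas (fun x => \sum_(i <- s) F i x).
Proof.
move=> bF; elim: s => [|i s IH].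
  by under eq_fun do rewrite big_nil; exact: bmeas_cst.
by under eq_fun do rewrite big_cons; exact: bmeasD.
Qed.

Lemma bmeas_prod (I : Type) (s : seq I) (F : I -> T -> R) :
  (forall i, bmeas (F i)) -> bmeas (fun x => \prod_(i <- s) F i x).
Proof.
move=> bF; elim: s => [|i s IH].
  by under eq_fun do rewrite big_nil; exact: bmeas_cst.
by under eq_fun do rewrite big_cons; exact: bmeasM.
Qed.

Lemma bmeas_indic (A : set T) : measurable A -> bmeas (\1_A : T -> R).
Proof.
move=> mA; split; first exact: measurable_indic.
exists 1 => x; rewrite indicE; case: (_ \in _); by rewrite ?normr1 ?normr0.
Qed.

End bounded_measurable.

Lemma bmeas_comp d d' (T : measurableType d) (T' : measurableType d')
    (R : realType) (h : T' -> T) (f : T -> R) :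
  measurable_fun setT h -> bmeas f -> bmeas (fun x => f (h x)).
Proof.
by move=> mh [mf [M fM]]; split; [exact: measurableT_comp|exists M => x].
Qed.

Lemma bmeas_sub d (T : measurableType d) (R : realType) (G : set (set T))
    (f : T -> R) : (G.-sigma.-measurable `<=` @measurable _ T) ->
  bmeas (f : g_sigma_algebraType G -> R) -> bmeas f.
Proof. by move=> sub [mf bf]; split => // mD A mA; apply: sub; exact: mf. Qed.

Section bounded_expectation.
Context d (T : measurableType d) (R : realType) (P : probability T R).
Implicit Types f g : T -> R.

Lemma bmeas_integrable f : bmeas f -> P.-integrable setT (EFin \o f).
Proof.
move=> [mf [M fM]]; apply: measurable_bounded_integrable => //.
  exact: fin_num_fun_lty.
exact: bounded_fun_norm_le fM.
Qed.

Lemma RintegralD_bmeas f g : bmeas f -> bmeas g ->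
  \int[P]_x (f x + g x) = \int[P]_x f x + \int[P]_x g x.
Proof. by move=> *; rewrite RintegralD//; exact: bmeas_integrable. Qed.

Lemma RintegralB_bmeas f g : bmeas f -> bmeas g ->
  \int[P]_x (f x - g x) = \int[P]_x f x - \int[P]_x g x.
Proof. by move=> *; rewrite RintegralB//; exact: bmeas_integrable. Qed.

Lemma RintegralZ_bmeas r f : bmeas f ->
  \int[P]_x (r * f x) = r * \int[P]_x f x.
Proof. by move=> *; rewrite RintegralZl//; exact: bmeas_integrable. Qed.

Lemma Rintegral_sum_bmeas (I : Type) (s : seq I) (F : I -> T -> R) :
  (forall i, bmeas (F i)) ->
  \int[P]_x (\sum_(i <- s) F i x) = \sum_(i <- s) \int[P]_x F i x.
Proof.
move=> bF; elim: s => [|i s IH].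
  under eq_Rintegral do rewrite big_nil.
  by rewrite big_nil Rintegral_cst// mul0r.
under eq_Rintegral do rewrite big_cons.
by rewrite big_cons RintegralD_bmeas// ?IH//; exact: bmeas_sum.
Qed.

Lemma le_Rintegral_bmeas f g : bmeas f -> bmeas g -> (forall x, f x <= g x) ->
  \int[P]_x f x <= \int[P]_x g x.
Proof. by move=> *; apply: le_Rintegral => //; exact: bmeas_integrable. Qed.

Lemma Rintegral_prob_cst r : \int[P]_x r = r.
Proof. rewrite Rintegral_cst// -[RHS]mulr1; congr (_ * _).
by rewrite -[RHS]/(fine 1%:E); congr fine; exact: probability_setT. Qed.

Lemma Rintegral_indic_prob (A : set T) : measurable A ->
  \int[P]_x \1_A x = fine (P A).
Proof. by move=> mA; rewrite /Rintegral integral_indic// setIT. Qed.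

Lemma ae_eq_Rintegral f g : measurable_fun setT f -> measurable_fun setT g ->
  {ae P, forall x, f x = g x} -> \int[P]_x f x = \int[P]_x g x.
Proof.
move=> mf mg fg; congr fine; apply: ae_eq_integral => //.
- exact/measurable_EFinP.
- exact/measurable_EFinP.
- by apply: filterS fg => x fgx _; rewrite fgx.
Qed.

(** A constant dominates the sequence, and it is integrable because the total
    mass is 1. *)
Lemma bounded_convergence (f_ : nat -> T -> R) f M :
  (forall n, measurable_fun setT (f_ n)) -> measurable_fun setT f ->
  (forall n x, `|f_ n x| <= M) ->
  {ae P, forall x, f_ n x @[n --> \oo] --> f x} ->
  \int[P]_x f_ n x @[n --> \oo] --> \int[P]_x f x.
Proof.
move=> mf_ mf fM ff.
have [|||||h1 h2 h3] := @dominated_convergence _ _ _ P setT measurableT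
  (fun n => EFin \o f_ n) (EFin \o f) (EFin \o cst M).
- by move=> n; exact/measurable_EFinP.
- exact/measurable_EFinP.
- by apply: filterS ff => x fx _; apply: cvg_EFin => //; exact: nearW.
- by apply: bmeas_integrable; exact: bmeas_cst.
- by apply: aeW => /= x n _; rewrite lee_fin.
apply: fine_cvg; rewrite fineK//; exact: integrable_fin_num.
Qed.

(** The expectation of h(phi) depends only on the law of phi: push both sides
    forward to Y. *)
Lemma Rintegral_eq_law d' (Y : measurableType d') (phi psi : T -> Y)
    (h : Y -> R) : measurable_fun setT phi -> measurable_fun setT psi ->
  (forall B, measurable B -> P (phi @^-1` B) = P (psi @^-1` B)) ->
  bmeas h -> \int[P]_x h (phi x) = \int[P]_x h (psi x).
Proof.
move=> mphi mpsi eqP bh.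
have bmi u : measurable_fun setT u -> P.-integrable (u @^-1` setT) ((EFin \o h) \o u).
  by move=> mu; rewrite preimage_setT; exact/bmeas_integrable/bmeas_comp/bh.
have mh : measurable_fun setT (EFin \o h) by apply/measurable_EFinP; case: bh.
rewrite /Rintegral; congr fine.
have := @integral_pushforward _ _ _ _ _ _ mphi P setT _ mh (bmi _ mphi) measurableT.
have := @integral_pushforward _ _ _ _ _ _ mpsi P setT _ mh (bmi _ mpsi) measurableT.
rewrite !preimage_setT => e1 e2.
transitivity (\int[pushforward P phi]_y (EFin \o h) y)%E; first by rewrite e2.
rewrite (eq_measure_integral (pushforward P psi)) ?e1//.
by move=> A mA _; exact: eqP.
Qed.

End bounded_expectation.

(** * The weak topology has a countable subbase *)

Section weak_topology_subbase.
Variables (R : realType) (T : ptopologicalType).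
Implicit Types f g : T -> R.

Lemma continuous_borel f : continuous f ->
  measurable_fun setT (f : borel T -> R).
Proof.
move=> /continuousP cf.
apply: (measurability _ (RGenOpens.measurableE R)).
move=> _ [_ [a [c ->] <-]]; rewrite setTI; apply: sub_sigma_algebra.
exact/cf/interval_open.
Qed.

Definition bcont f := continuous f /\ exists M, forall x, `|f x| <= M.

Lemma bcont_bmeas f : bcont f -> bmeas (f : borel T -> R).
Proof. by move=> [cf fM]; split => //; exact: continuous_borel. Qed.

Lemma bcont_bounded_continuous f : bcont f -> continuous f /\ bounded_fun f.
Proof. by move=> [cf [M fM]]; split => //; exact: bounded_fun_norm_le fM. Qed.

Lemma bcontB f g : bcont f -> bcont g -> bcont (fun x => f x - g x).
Proof.
move=> [cf [M fM]] [cg [N gN]]; split.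
  by move=> x; apply: cvgB; [exact: cf|exact: cg].
by exists (M + N) => x; rewrite (le_trans (ler_normB _ _))// lerD.
Qed.

Lemma bcont_cst r : bcont (fun=> r).
Proof. by split; [move=> x; exact: cvg_cst|exists `|r|]. Qed.

(** By definition the weak topology is the initial topology for the integrals
    of bounded continuous functions. *)
Lemma cvg_integral (F : set_system (prob_space R T)) (mu : prob_space R T) f :
  Filter F -> bcont f -> F --> mu ->
  (fun nu : prob_space R T => \int[nu]_x f x) @ F --> (\int[mu]_x f x : R).
Proof.
move=> FF bf Fmu; pose g : bounded_continuous R T :=
  exist _ f (bcont_bounded_continuous bf).
have h : @integrate R T @ F --> @integrate R T mu.
  exact: cvg_trans (cvg_app _ Fmu) (@initial_continuous _ _ (@integrate R T) mu).
have /cvg_sup/(_ g) {}h := h.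
exact: cvg_trans (cvg_app _ h) (@initial_continuous _ _
  (fun y : prod_topology (fun=> R : topologicalType) => y g) (integrate mu)).
Qed.

Lemma continuous_integral f : bcont f ->
  continuous (fun mu : prob_space R T => \int[mu]_x f x : R).
Proof. by move=> bf mu; apply: (@cvg_integral (nbhs mu)) => //; exact: cvg_id. Qed.

Variables (b : nat -> T -> R) (bb : bump_family b).

(** Finite maxima of rational multiples of bumps have a countable type of
    indices and are continuous, so that their integrals are continuous in the
    measure. *)
Definition tent (s : seq (nat * rat)) : T -> R :=
  fun x => \big[Num.max/0]_(p <- s) (ratr p.2 * b p.1 x).

Lemma tent_cons p s x :
  tent (p :: s) x = Num.max (ratr p.2 * b p.1 x) (tent s x).
Proof. by rewrite /tent big_cons. Qed.

Lemma tent_ge0 s x : 0 <= tent s x.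
Proof.
elim: s => [|p s IH]; first by rewrite /tent big_nil.
by rewrite tent_cons le_max IH orbT.
Qed.

Lemma tent_ge s p x : p \in s -> ratr p.2 * b p.1 x <= tent s x.
Proof.
elim: s => [//|q s IH]; rewrite inE tent_cons le_max => /predU1P[->|/IH ->].
  by rewrite lexx.
by rewrite orbT.
Qed.

Lemma tent_le s x r : 0 <= r ->
  (forall p, p \in s -> ratr p.2 * b p.1 x <= r) -> tent s x <= r.
Proof.
move=> r0; elim: s => [|p s IH] sr; first by rewrite /tent big_nil.
rewrite tent_cons ge_max sr ?mem_head//= IH// => q qs.
by rewrite sr// inE qs orbT.
Qed.

Lemma tent_bcont s : bcont (tent s).
Proof.
have [bc b01 _] := bb; elim: s => [|p s [cs [M sM]]].
  rewrite (_ : tent [::] = fun=> 0); first exact: bcont_cst.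
  by apply/funext => x; rewrite /tent big_nil.
rewrite (_ : tent _ = (fun x => ratr p.2 * b p.1 x) \max tent s); last first.
  by apply/funext => x; rewrite tent_cons.
split.
  move=> x; apply: (@continuous_max R); last exact: cs.
  by apply: cvgM; [exact: cvg_cst|exact: bc].
exists (`|ratr p.2| + M) => x.
have /andP[b0 b1] := b01 p.1 x.
have h1 : `|ratr p.2 * b p.1 x| <= `|ratr p.2| :> R.
  by rewrite normrM (ger0_norm b0) ler_piMr.
have M0 : 0 <= M by apply: le_trans (sM x).
rewrite -[_ x]/(Num.max (ratr p.2 * b p.1 x) (tent s x)).
have [h|h] := leP (ratr p.2 * b p.1 x) (tent s x).
  by rewrite (le_trans (sM x))// lerDr.
by rewrite (le_trans h1)// lerDl.
Qed.

(** A nonnegative continuous f is the supremum of the countably many functions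
    q b_k that stay below it: near x, f exceeds any rational q < f(x), so some
    bump equal to 1 at x and supported there satisfies q b_k <= f. Taking the
    maximum over the first n such functions makes this a sequence. *)
Lemma tent_approx f : continuous f -> (forall x, 0 <= f x) ->
  exists s_ : nat -> seq (nat * rat),
    (forall n x, tent (s_ n) x <= f x) /\
    (forall x, tent (s_ n) x @[n --> \oo] --> f x).
Proof.
move=> cf f0; have [bc b01 bU] := bb.
pose below (p : nat * rat) := `[< forall x, ratr p.2 * b p.1 x <= f x >].
pose s_ n := [seq p <- pmap choice.unpickle (iota 0 n) | below p].
have s_f n x : tent (s_ n) x <= f x.
  by apply: tent_le => // p; rewrite mem_filter => /andP[/asboolP].
exists s_; split => // x; apply/cvgrPdist_lt => e e0.
have [fe|fe] := ltP (f x) e.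
  apply: nearW => n; rewrite ger0_norm ?subr_ge0//.
  by rewrite (le_lt_trans _ fe)// gerBl tent_ge0.
have /rat_in_itvoo[q /itvP q_] : Num.max 0 (f x - e / 2) < f x.
  by rewrite gt_max (lt_le_trans e0 fe)/= ltrBlDr ltrDl divr_gt0.
have [q0 qe] : 0 <= ratr q :> R /\ f x - e / 2 <= ratr q.
  by apply/andP; rewrite -ge_max q_.
have qx : nbhs x [set y | ratr q < f y].
  by apply: (cvgr_gt (f x)); [exact: cf|rewrite q_].
have [k bkx bkU] := bU _ _ qx.
have below_kq : below (k, q).
  apply/asboolP => y /=; have /andP[bk0 bk1] := b01 k y.
  have [bky|bky] := ltP 0 (b k y); last first.
    by rewrite (_ : b k y = 0) ?mulr0//; apply/eqP; rewrite eq_le bky bk0.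
  by rewrite (le_trans _ (ltW (bkU _ bky)))// ler_piMr.
near=> n; rewrite ger0_norm ?subr_ge0// ltrBlDr.
have : (k, q) \in s_ n.
  rewrite mem_filter below_kq mem_pmap; apply/mapP.
  exists (choice.pickle (k, q)); last by rewrite choice.pickleK.
  by rewrite mem_iota /=; near: n; exact: nbhs_infty_gt.
move=> /(tent_ge x) /=; rewrite bkx mulr1; lra.
Unshelve. all: by end_near. Qed.

(** These sets bound integrals only from below; upper bounds come from applying
    [weak_subbase_lower] to the opposite function. *)
Definition weak_subbase (p : seq (nat * rat) * rat) : set (prob_space R T) :=
  [set mu : prob_space R T | ratr p.2 < \int[mu]_x tent p.1 x].

(** Adding a constant makes f nonnegative. A tent function h below f whose
    integral against mu nearly reaches that of f then gives a neighbourhood: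
    if the integral of h against nu stays large, so does that of f >= h. *)
Lemma weak_subbase_lower (mu : prob_space R T) f (e : R) : bcont f -> 0 < e ->
  subbase_nbhs weak_subbase mu
    [set nu : prob_space R T | \int[mu]_x f x - e < \int[nu]_x f x].
Proof.
move=> bf e0; have [cf [M fM]] := bf.
(* Every nu is a probability, so this shift changes all integrals by M. *)
pose g x := f x - (- M).
have bg : bcont g by apply: bcontB => //; exact: bcont_cst.
have g0 x : 0 <= g x by rewrite subr_ge0; have := fM x; rewrite ler_norml => /andP[].
have ig (nu : prob_space R T) : \int[nu]_x g x = \int[nu]_x f x + M.
  rewrite (@RintegralB_bmeas _ (borel T)).
  - by rewrite (@Rintegral_prob_cst _ (borel T)) opprK.
  - exact: bcont_bmeas.
  - exact: bmeas_cst.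
have [s_ [s_g s_cvg]] := tent_approx (proj1 bg) g0.
have : \int[mu]_x tent (s_ n) x @[n --> \oo] --> \int[mu]_x g x.
  apply: (@bounded_convergence _ (borel T) R mu _ _ (M + M)).
  - by move=> n; case: (bcont_bmeas (tent_bcont (s_ n))).
  - by case: (bcont_bmeas bg).
  - move=> n x; rewrite ger0_norm ?tent_ge0// (le_trans (s_g n x))//.
    by rewrite /g opprK lerD2r; have := fM x; rewrite ler_norml => /andP[].
  - by apply: aeW => x; exact: s_cvg.
move=> /cvgr_gt /(_ (\int[mu]_x g x - e)).
rewrite ltrBlDr ltrDl e0 => /(_ isT)[n _ /(_ n (leqnn n)) /=].
move=> /rat_in_itvoo[r /itvP r_].
have FF := subbase_nbhs_filter weak_subbase mu.
apply: filterS (subbase_nbhs_mem (_ : weak_subbase (s_ n, r) mu)).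
  move=> nu; rewrite /weak_subbase /= => rnu.
  have : \int[nu]_x tent (s_ n) x <= \int[nu]_x g x.
    apply: (@le_Rintegral_bmeas _ (borel T)); [|exact: bcont_bmeas|exact: s_g].
    exact/bcont_bmeas/tent_bcont.
  have : \int[mu]_x g x - e < ratr r by rewrite r_.
  rewrite !ig; lra.
by rewrite /weak_subbase /= r_.
Qed.

Lemma weak_subbaseP mu : subbase_nbhs weak_subbase mu `=>` nbhs mu.
Proof.
have FF := subbase_nbhs_filter weak_subbase mu.
apply: cvg_initial; apply: cvg_prod => -[f [cf fb]] /=.
have bf : bcont f by split=> //; exact: bounded_fun_ex.
apply/cvgrPdist_lt => e e0 /=.
have bNf : bcont (fun x => 0 - f x) by apply: bcontB => //; exact: bcont_cst.
have iN (nu : prob_space R T) : \int[nu]_x (0 - f x) = - \int[nu]_x f x.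
  rewrite (@RintegralB_bmeas _ (borel T)).
  - by rewrite (@Rintegral_prob_cst _ (borel T)) sub0r.
  - exact: bmeas_cst.
  - exact: bcont_bmeas.
apply: filterS2 (weak_subbase_lower mu bf e0) (weak_subbase_lower mu bNf e0).
by move=> nu /=; rewrite !iN /integrate /= ltr_norml => *; lra.
Qed.

End weak_topology_subbase.

(** * The Borel sigma-algebra of the space of systems *)

Lemma borel_open (T : ptopologicalType) (U : set T) :
  open U -> measurable (U : set (borel T)).
Proof. exact: sub_sigma_algebra. Qed.

Lemma continuous_measurable_borel (T U : ptopologicalType) (f : T -> U) :
  continuous f -> measurable_fun setT (f : borel T -> borel U).
Proof.
move=> /continuousP cf; apply: (measurability _ (erefl : @measurable _ (borel U) = <<s @open U >>)).
by move=> _ [V oV <-]; rewrite setTI; apply: borel_open; exact: cf.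
Qed.

Lemma product_coord_continuous (I : Type) (T : I -> ptopologicalType) i :
  continuous (fun x : product_space T => x i).
Proof.
move=> x; have /cvg_sup/(_ i) h : nbhs x --> x by exact: cvg_id.
exact: cvg_trans (cvg_app _ h)
  (@initial_continuous (forall i, T i) (T i) (fun y => y i) x).
Qed.

Lemma product2_coord_continuous (I : Type) (J : I -> Type)
    (T : forall i, J i -> ptopologicalType) i j :
  continuous (fun x : product_space (fun i => product_space (@T i)) => x i j).
Proof.
move=> x.
apply: (@continuous_comp (product_space (fun i => product_space (@T i)))
  (product_space (@T i)) (T i j) (fun x => x i) (fun x => x j)).
  exact: product_coord_continuous.
exact: product_coord_continuous.
Qed.

Section system_space.
Variables (R : realType) (C : nat) (S : 'I_C -> ptopologicalType).
Variables (b : forall i, nat -> S i -> R) (bb : forall i, bump_family (@b i)).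
Local Notation SS := (system_space S).

Lemma system_coord_continuous i n : continuous (fun x : SS => x i n).
Proof. exact: (@product2_coord_continuous _ (fun=> nat) (fun i _ => S i) i n). Qed.

Lemma system_coord_measurable i n :
  measurable_fun setT ((fun x => x i n) : borel SS -> borel (S i)).
Proof.
exact: (@continuous_measurable_borel SS (S i) (fun x => x i n)
  (@system_coord_continuous i n)).
Qed.

Definition cylinder_base (p : 'I_C * nat * nat) : set SS :=
  [set x | 0 < b p.2 (x p.1.1 p.1.2)].

Lemma cylinder_baseP x : subbase_nbhs cylinder_base x `=>` nbhs x.
Proof.
have FF := subbase_nbhs_filter cylinder_base x.
apply: cvg_prod => i; apply: cvg_prod => n U.
have [_ _ bU] := bb i.
move=> /bU[k bk kU].
have := @subbase_nbhs_mem _ _ cylinder_base (i, n, k) x.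
rewrite /cylinder_base /= bk => /(_ ltr01); apply: filterS => y /=; exact: kU.
Qed.

Lemma measurable_system d (Omega : measurableType d) (phi : Omega -> SS) :
  (forall i n, measurable_fun setT ((fun w => phi w i n) : Omega -> borel (S i))) ->
  measurable_fun setT (phi : Omega -> borel SS).
Proof.
move=> mphi; apply: (measurability _ (erefl : @measurable _ (borel SS) = <<s @open SS >>)).
move=> _ [V oV <-]; rewrite setTI.
apply: (measurable_preimage_open cylinder_baseP) => // -[[i n] k].
rewrite -[X in measurable X]setTI.
apply: (mphi i n measurableT [set y | 0 < b k y]).
have [bc _ _] := bb i; apply: borel_open.
rewrite (_ : mkset _ = b k @^-1` [set r | 0 < r])//.
by apply: open_comp => [y _|]; [exact: bc|exact: open_gt].
Qed.

(** Equality to 1 from some index on expresses that the box constrains only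
    finitely many coordinates, without naming them; this makes the family
    stable under pointwise product. *)
Definition box_test (f : forall i, nat -> S i -> R) :=
  [/\ forall i n, continuous (f i n), forall i n x, 0 <= f i n x <= 1
    & exists N, forall i n, (N <= n)%N -> f i n = fun=> 1].

Definition box (f : forall i, nat -> S i -> R) : set SS :=
  [set x | forall i n, 0 < f i n (x i n)].

Definition boxes : set (set SS) := [set box f | f in box_test].

(** The product of two nonnegative numbers is positive exactly when both are. *)
Lemma boxesI : setI_closed boxes.
Proof.
move=> _ _ [f [cf f01 [N fN]] <-] [g [cg g01 [M gM]] <-].
exists (fun i n y => f i n y * g i n y).
  split.
  - by move=> i n x; apply: cvgM; [exact: cf|exact: cg].
  - move=> i n x; have /andP[f0 f1] := f01 i n x; have /andP[g0 g1] := g01 i n x.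
    by rewrite mulr_ge0//= mulr_ile1.
  - exists (maxn N M) => i n; rewrite geq_max => /andP[Nn Mn].
    by rewrite fN// gM//; apply/funext => y; rewrite mulr1.
apply/seteqP; split => [x fg|x [fx gx] i n]; last by rewrite mulr_gt0.
have h i n : 0 < f i n (x i n) /\ 0 < g i n (x i n).
  have := fg i n; have /andP[f0 _] := f01 i n (x i n).
  have /andP[g0 _] := g01 i n (x i n).
  rewrite !lt0r f0 g0 !andbT mulf_eq0 negb_or => /andP[/andP[-> ->]].
  by [].
by split=> i n; have [] := h i n.
Qed.

Lemma box_measurable f : box_test f -> measurable (box f : set (borel SS)).
Proof.
move=> [cf _ _].
rewrite (_ : box f = \bigcap_i \bigcap_n [set x : SS | 0 < f i n (x i n)]).
  apply: fin_bigcap_measurable => // i _; apply: bigcapT_measurable => n.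
  apply: borel_open.
  rewrite (_ : mkset _ = (fun x : SS => f i n (x i n)) @^-1` [set r | 0 < r])//.
  apply: open_comp => [y _|]; last exact: open_gt.
  by apply: continuous_comp; [exact: system_coord_continuous|exact: cf].
by apply/seteqP; split => x /= H; [move=> i _ n _; exact: H|
  move=> i n; exact: H].
Qed.

(** The space of systems is a countable product of spaces with a countable
    subbase of sets {b_k > 0}, so its open sets belong to the sigma-algebra
    generated by the boxes. *)
Lemma borel_boxes : @measurable _ (borel SS) = <<s boxes >>.
Proof.
apply/seteqP; split.
  apply: smallest_sub; first exact: smallest_sigma_algebra.
  move=> U oU.
  have := @measurable_preimage_open SS _ cylinder_base _
    (g_sigma_algebraType boxes) id cylinder_baseP _ U oU.
  apply => -[[i n] k].
  apply: sub_sigma_algebra.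
  have [bc b01 _] := bb i.
  exists (fun j m => if (j == i) && (m == n) then b k else fun=> 1).
    split.
    - move=> j m x; case: ifPn => _; last exact: cvg_cst.
      by have [bc' _ _] := bb j; exact: bc'.
    - move=> j m x; case: ifPn => _; last by rewrite ler01 lexx.
      by have [_ b01' _] := bb j; exact: b01'.
    - exists n.+1 => j m nm; case: ifPn => // /andP[_ /eqP mn].
      by rewrite mn ltnn in nm.
  apply/seteqP; split => x /=.
    by move/(_ i n); rewrite !eqxx.
  move=> bx j m; case: ifPn => // /andP[/eqP ji /eqP ->].
  by rewrite ji.
apply: smallest_sub; first exact: sigma_algebra_measurable.
by move=> _ [f tf <-]; exact: box_measurable.
Qed.

Lemma box_setT : boxes setT.
Proof.
exists (fun i n _ => 1).
  by split=> [i n x|i n x|]; [exact: cvg_cst|rewrite ler01 lexx|exists 0%N].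
by apply/seteqP; split => // x _ i n; exact: ltr01.
Qed.

Lemma eq_law_boxes d (Omega : measurableType d) (P : probability Omega R)
    (phi psi : Omega -> borel SS) :
  measurable_fun setT phi -> measurable_fun setT psi ->
  (forall f, box_test f -> P (phi @^-1` box f) = P (psi @^-1` box f)) ->
  forall B, measurable B -> P (phi @^-1` B) = P (psi @^-1` B).
Proof.
move=> mphi mpsi e B mB.
have := @measure_unique _ R (borel SS) boxes (fun=> setT) borel_boxes boxesI
  (fun=> box_setT) _ (pushforward P phi) (pushforward P psi) _ _ B mB.
apply => //.
- by rewrite bigcup_const.
- by move=> _ [f tf <-]; exact: e.
- move=> _; apply: (@le_lt_trans _ _ 1%E); last exact: ltry.
  exact: (@probability_le1 _ _ _ P setT measurableT).
Qed.

End system_space.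

(** * Integrals against empirical measures *)

Section empirical_integral.
Variables (R : realType) (T : ptopologicalType) (x : nat -> T).

Lemma integral_empirical_ge0 K (f : T -> R) : bmeas (f : borel T -> R) ->
  (forall y, 0 <= f y) ->
  \int[empirical_measure R x K]_y f y = K.+1%:R^-1 * \sum_(j < K.+1) f (x j).
Proof.
move=> [mf _] f0; rewrite /Rintegral.
have mEf : measurable_fun setT (EFin \o f : borel T -> \bar R).
  exact/measurable_EFinP.
have -> : (\int[empirical_measure R x K]_y (f y)%:E =
    (K.+1%:R^-1)%:E * \sum_(j < K.+1) (f (x j))%:E)%E.
  rewrite (@ge0_integral_mscale _ (borel T))//; last by move=> y _; rewrite lee_fin.
  congr (_ * _)%E; rewrite (@ge0_integral_measure_sum _ (borel T))//.
    apply: eq_bigr => j _; rewrite (@integral_dirac _ (borel T))//.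
    by rewrite diracT mul1e.
  by move=> y _; rewrite lee_fin.
by rewrite sumEFin -EFinM.
Qed.

(** The integral against a finite sum of Dirac masses is computed for
    nonnegative functions; a constant shift reduces a bounded function to
    that case. *)
Lemma integral_empirical K (f : T -> R) : bmeas (f : borel T -> R) ->
  \int[empirical_measure R x K]_y f y = K.+1%:R^-1 * \sum_(j < K.+1) f (x j).
Proof.
move=> bf; have [mf [M fM]] := bf.
have bM : bmeas ((fun=> M) : borel T -> R) by exact: bmeas_cst.
have e : \int[empirical_measure R x K]_y (f y + M) =
    \int[empirical_measure R x K]_y f y + M.
  rewrite (@RintegralD_bmeas _ (borel T))//.
  by rewrite (@Rintegral_prob_cst _ (borel T)).
apply: (addIr M); rewrite -e integral_empirical_ge0.
- rewrite big_split/= mulrDr; congr (_ + _).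
  have -> : \sum_(j < K.+1) M = K.+1%:R * M.
    by rewrite sumr_const card_ord mulr_natl.
  by rewrite mulrA mulVf ?mul1r.
- exact: bmeasD.
- by move=> y; have := fM y; rewrite ler_norml => /andP[]; lra.
Qed.

End empirical_integral.

(** * Transpositions of the index set *)

Definition swapn (a c n : nat) : nat :=
  if n == a then c else if n == c then a else n.

Lemma swapn_id a c n : n != a -> n != c -> swapn a c n = n.
Proof. by rewrite /swapn => /negbTE -> /negbTE ->. Qed.

Lemma swapnl a c : swapn a c a = c.
Proof. by rewrite /swapn eqxx. Qed.

Lemma swapnr a c : swapn a c c = a.
Proof. by rewrite /swapn eqxx; case: eqVneq. Qed.

Lemma swapnK a c : involutive (swapn a c).
Proof.
move=> n; have [->|na] := eqVneq n a; first by rewrite swapnl swapnr.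
have [->|nc] := eqVneq n c; first by rewrite swapnr swapnl.
by rewrite !(swapn_id na nc).
Qed.

Lemma val_tperm M (a c n : 'I_M) : tperm a c n = swapn a c n :> nat.
Proof.
case: tpermP => [->|->|/eqP na /eqP nc]; rewrite ?swapnl ?swapnr//.
by rewrite swapn_id.
Qed.

Section transpositions.
Variables (C : nat) (S : 'I_C -> ptopologicalType).
Local Notation SS := (system_space S).

Definition transp (i : 'I_C) (a c : nat) : 'I_C -> nat -> nat :=
  fun j => if j == i then swapn a c else id.

Definition reindex_system (s : 'I_C -> nat -> nat) (x : SS) : SS :=
  fun i n => x i (s i n).

End transpositions.

(** * Variables that ignore transpositions of the system *)

Section transp_invariant_variables.
Context d (Omega : measurableType d) (R : realType) (P : probability Omega R).
Variables (C : nat) (S : 'I_C -> ptopologicalType).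
Variables (b : forall i, nat -> S i -> R) (bb : forall i, bump_family (@b i)).
Variable X : nat -> forall i : 'I_C, {RV P >-> borel (S i)}.
Hypothesis HX : multi_exchangeable X.
Local Notation SS := (system_space S).

Lemma system_measurable : measurable_fun setT (system X : Omega -> borel SS).
Proof. by apply: (measurable_system bb) => i n; exact: measurable_funPT. Qed.

Lemma reindex_measurable s : measurable_fun setT
  (reindex_system s : borel SS -> borel SS).
Proof. by apply: (measurable_system bb) => i n; exact: system_coord_measurable. Qed.

Lemma reindexed_system_measurable s :
  measurable_fun setT ((fun w => reindex_system s (system X w)) : Omega -> borel SS).
Proof. exact: measurableT_comp (reindex_measurable s) system_measurable. Qed.

(** Boxes depend on finitely many coordinates, so the exchangeability of a
    finite sub-system gives the equality of probabilities on boxes, and boxes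
    form a pi-system generating the Borel sets. *)
Lemma law_transp i a c (B : set (borel SS)) : measurable B ->
  P (system X @^-1` B) =
  P ((fun w => reindex_system (transp i a c) (system X w)) @^-1` B).
Proof.
move: B; apply: (eq_law_boxes bb system_measurable (reindexed_system_measurable _)).
move=> f [cf f01 [N fN]].
(* The first M rows contain both transposed indices and all the coordinates that
   the box constrains. *)
pose M := (maxn N (maxn a c)).+1.
have aM : (a < M)%N by rewrite ltnS !leq_max leqnn orbT.
have cM : (c < M)%N by rewrite ltnS !leq_max leqnn !orbT.
pose NN : 'I_C -> nat := fun=> M.
pose s : forall j, {perm 'I_(NN j)} :=
  fun j => if j == i then tperm (Ordinal aM) (Ordinal cM) else 1%g.
have sE j n : s j n = transp i a c j n :> nat.
  rewrite /s /transp; case: ifPn => _; last by rewrite perm1.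
  by rewrite val_tperm.
pose B' : set (borel (finite_system_space S NN)) :=
  [set y | forall j (n : 'I_M), 0 < f j n (y j n)].
have mB' : measurable B'.
  rewrite (_ : B' = \bigcap_j \bigcap_(n in [set: 'I_M])
      [set y : finite_system_space S NN | 0 < f j n (y j n)]).
    apply: fin_bigcap_measurable => // j _; apply: fin_bigcap_measurable => // n _.
    apply: borel_open.
    rewrite (_ : mkset _ = (fun y : finite_system_space S NN => f j n (y j n))
      @^-1` [set r | 0 < r])//.
    apply: open_comp => [y _|]; last exact: open_gt.
    apply: continuous_comp; last exact: cf.
    exact: (@product2_coord_continuous _ (fun j => 'I_(NN j)) (fun j _ => S j) j n).
  by apply/seteqP; split => y /= H; [move=> j _ n _; exact: H|
    move=> j n; exact: H].
have := HX s mB'; rewrite /pushforward => e.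
transitivity (P ((fun w => (fun j n => X n j w) : borel (finite_system_space S NN))
    @^-1` B')).
  congr (P _); apply/seteqP; split => w /= H; first by move=> j n; exact: H.
  move=> j n; have [nM|nM] := ltnP n M; first exact: (H j (Ordinal nM)).
  by rewrite fN ?ltr01// (leq_trans _ (ltnW nM))// leq_max leqnn.
rewrite e; congr (P _); apply/seteqP; split => w /= H.
  move=> j n; rewrite /reindex_system /system.
  have [nM|nM] := ltnP n M; last first.
    by rewrite fN ?ltr01// (leq_trans _ (ltnW nM))// leq_max leqnn.
  by have := H j (Ordinal nM); rewrite sE.
by move=> j n; rewrite sE; exact: H.
Qed.

(** For Y a function of the system this amounts to the invariance of Y under
    transpositions. Writing it through expectations avoids representing Y by
    such a function, and makes the property insensitive to null sets and
    stable under bounded limits. *)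
Definition transp_invariant (Y : Omega -> R) := bmeas Y /\
  forall i a c (h : borel SS -> R), bmeas h ->
    \int[P]_w (Y w * h (system X w)) =
    \int[P]_w (Y w * h (reindex_system (transp i a c) (system X w))).

Lemma transp_bij (i : 'I_C) a c j : bijective (transp i a c j).
Proof.
rewrite /transp; case: ifPn => _; first exact/inv_bij/swapnK.
by exists id.
Qed.

Lemma exch_sigma_measurable A : exch_sigma X A -> measurable A.
Proof.
move=> /(_ 1%N (ltnSn 0)) [B [mB _] <-].
by rewrite -[X in measurable X]setTI; exact: system_measurable.
Qed.

(** If A is the event that the system lies in B, with B invariant under
    permutations of the first k rows, then 1_A h and its transposed version
    are the same function 1_B h evaluated at two systems of equal law. *)
Lemma transp_invariant_exch A : exch_sigma X A -> transp_invariant (\1_A).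
Proof.
move=> eA; split; first by apply: bmeas_indic; exact: exch_sigma_measurable.
move=> i a c h bh.
(* The transposition of a and c fixes every index from max(a, c) + 1 on. *)
have [B [mB kB] AB] := eA (maxn a c).+1 (ltn0Sn _).
have BE w : (\1_A w : R) = \1_B (system X w) by rewrite -AB !indicE.
have tB x : (\1_B (reindex_system (transp i a c) x) : R) = \1_B x.
  have [|Bt tB] := kB (transp i a c) (transp_bij i a c) _ x.
    move=> j n; rewrite gtn_max => /andP[an cn]; rewrite /transp.
    by case: ifPn => // _; rewrite swapn_id ?gtn_eqF.
  rewrite !indicE; congr (_%:R); congr nat_of_bool.
  by apply/idP/idP; rewrite !inE; [exact: tB|exact: Bt].
under eq_Rintegral do rewrite BE.
under [RHS]eq_Rintegral do rewrite BE -(tB (system X _)).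
apply: (Rintegral_eq_law (h := fun x => \1_B x * h x) system_measurable
  (reindexed_system_measurable (transp i a c))).
  exact: law_transp.
by apply: bmeasM => //; exact: bmeas_indic.
Qed.

End transp_invariant_variables.

(** * Empirical means converge to integrals against the directing measure *)

(** The first K + 1 terms are averaged, as in the empirical measures. *)
Definition mean (R : realType) (u : nat -> R) (K : nat) : R :=
  K.+1%:R^-1 * \sum_(j < K.+1) u j.

Lemma mean_bounded (R : realType) (u : nat -> R) M K :
  (forall j, `|u j| <= M) -> `|mean u K| <= M.
Proof.
move=> uM; rewrite /mean normrM ger0_norm ?invr_ge0 ?ler0n// ler_pdivrMl ?ltr0n//.
rewrite (le_trans (ler_norm_sum _ _ _))//.
apply: (@le_trans _ _ (\sum_(j < K.+1) M)); first exact: ler_sum.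
by rewrite sumr_const card_ord mulr_natl.
Qed.

(** This is the Cesaro theorem. Applied to differences, it says that limits of
    means do not see finitely many terms. *)
Lemma mean_cvg_eventually (R : realType) (u : nat -> R) (l : R) N :
  (forall j, (N <= j)%N -> u j = l) -> mean u @ \oo --> l.
Proof.
move=> ul; rewrite (_ : mean u = arithmetic_mean u).
  by apply: cesaro; apply: cvg_near_cst; exists N.
by apply/funext => K; rewrite /mean /arithmetic_mean /= seriesEord.
Qed.

Lemma mean_swapn (R : realType) (u : nat -> R) a c K :
  (a <= K)%N -> (c <= K)%N -> mean (u \o swapn a c) K = mean u K.
Proof.
move=> aK cK; rewrite /mean; congr (_ * _).
rewrite [RHS](reindex_inj (@perm_inj _
  (tperm (Ordinal (aK : (a < K.+1)%N)) (Ordinal (cK : (c < K.+1)%N))))) /=.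
by apply: eq_bigr => j _; rewrite val_tperm.
Qed.

(** The integral of f is a continuous function of the measure. The domain is an
    arbitrary measurable space so that the lemma also applies to the
    sigma-algebra generated by the directing measures. *)
Lemma integral_kernel_bmeas d (T : measurableType d) (R : realType)
    (S : ptopologicalType) (L : T -> borel (prob_space R S)) (f : S -> R) :
  measurable_fun setT L -> bcont f ->
  bmeas (fun w => \int[(L w : prob_space R S)]_x f x).
Proof.
move=> mL bf; split.
  exact: measurableT_comp (continuous_borel (continuous_integral bf)) mL.
have [_ [M fM]] := bf; exists M => w.
have bmf := bcont_bmeas bf.
apply: (le_trans (le_normr_Rintegral measurableT _)).
  exact: (@bmeas_integrable _ (borel S)).
rewrite -[leRHS](@Rintegral_prob_cst _ (borel S) R (L w : prob_space R S)).
apply: (@le_Rintegral_bmeas _ (borel S)) => //; first exact: bmeas_norm.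
exact: bmeas_cst.
Qed.

Section directing_measure.
Context d (Omega : measurableType d) (R : realType) (P : probability Omega R).
Variables (C : nat) (S : 'I_C -> ptopologicalType).
Variable X : nat -> forall i : 'I_C, {RV P >-> borel (S i)}.
Variable Lambda : forall i : 'I_C, {RV P >-> borel (prob_space R (S i))}.
Hypothesis HLambda : forall i, is_directing_measure (fun n => X n i) (Lambda i).

Definition Lambda_integral i (f : S i -> R) (w : Omega) : R :=
  \int[(Lambda i w : prob_space R (S i))]_x f x.

Lemma Lambda_integral_bmeas i f : bcont f -> bmeas (@Lambda_integral i f).
Proof. by move=> bf; apply: integral_kernel_bmeas => //; exact: measurable_funPT. Qed.

Lemma coord_bmeas i n (f : S i -> R) : bcont f -> bmeas (fun w => f (X n i w)).
Proof.
move=> bf; apply: (bmeas_comp (measurable_funPT (X n i)) (bcont_bmeas bf)).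
Qed.

Lemma mean_cvg_Lambda_integral i (f : S i -> R) : bcont f ->
  {ae P, forall w, mean (fun n => f (X n i w)) @ \oo --> Lambda_integral f w}.
Proof.
move=> bf; apply: filterS (HLambda i) => w Xw.
have h := cvg_integral (fmap_filter _ _) bf Xw.
rewrite (_ : mean _ = (fun nu : prob_space R (S i) => \int[nu]_x f x) \o
  (fun K => empirical_measure R (fun n => X n i w : S i) K)); first exact: h.
by apply/funext => K /=; rewrite (integral_empirical _ _ (bcont_bmeas bf)).
Qed.

Lemma mean_bmeas i (f : S i -> R) K : bcont f ->
  bmeas (fun w => mean (fun n => f (X n i w)) K).
Proof.
move=> bf; apply: bmeasM; first exact: bmeas_cst.
apply: (@bmeas_sum _ _ R _ _ (fun (j : 'I_K.+1) w => f (X j i w))) => j.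
exact: coord_bmeas.
Qed.

(** The empirical means are bounded by the bound of f, so almost sure
    convergence passes to expectations. *)
Lemma Rintegral_mean_cvg i (f : S i -> R) (Z : Omega -> R) : bcont f -> bmeas Z ->
  \int[P]_w (mean (fun n => f (X n i w)) K * Z w) @[K --> \oo] -->
  \int[P]_w (Lambda_integral f w * Z w).
Proof.
move=> bf [mZ [N ZN]]; have [_ [M fM]] := bf.
apply: (@bounded_convergence _ _ _ P _ _ (M * N)).
- by move=> K; apply: measurable_funM => //; case: (mean_bmeas K bf).
- by apply: measurable_funM => //; case: (Lambda_integral_bmeas bf).
- by move=> K w; rewrite normrM ler_pM//; exact: mean_bounded.
- apply: filterS (mean_cvg_Lambda_integral bf) => w h.
  by apply: cvgM; [exact: h|exact: cvg_cst].
Qed.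

End directing_measure.

(** * Replacing coordinates by the directing measures *)

Section product_formula.
Context d (Omega : measurableType d) (R : realType) (P : probability Omega R).
Variables (C : nat) (S : 'I_C -> ptopologicalType).
Variables (b : forall i, nat -> S i -> R) (bb : forall i, bump_family (@b i)).
Variable X : nat -> forall i : 'I_C, {RV P >-> borel (S i)}.
Variable Lambda : forall i : 'I_C, {RV P >-> borel (prob_space R (S i))}.
Hypothesis HLambda : forall i, is_directing_measure (fun n => X n i) (Lambda i).
Local Notation SS := (system_space S).

Lemma system_bmeas (h : borel SS -> R) : bmeas h ->
  bmeas (fun w => h (system X w)).
Proof. by move=> bh; apply: bmeas_comp bh; exact: (system_measurable bb). Qed.

Lemma reindexed_system_bmeas s (h : borel SS -> R) : bmeas h ->
  bmeas (fun w => h (reindex_system s (system X w))).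
Proof. by move=> bh; apply: bmeas_comp bh; exact: (reindexed_system_measurable bb). Qed.

Lemma system_space_coord_bmeas i n (f : S i -> R) : bcont f ->
  bmeas ((fun x => f (x i n)) : borel SS -> R).
Proof.
move=> bf; exact: (bmeas_comp (@system_coord_measurable C S i n) (bcont_bmeas bf)).
Qed.

(** The integral of f against Lambda_i is the limit of empirical means of f,
    and a mean over K + 1 terms is a function of the system that a
    transposition of two indices up to K leaves unchanged. *)
Lemma transp_invariant_Lambda_integral (Y : Omega -> R) i (f : S i -> R) :
  transp_invariant X Y -> bcont f -> transp_invariant X (fun w => Y w * Lambda_integral Lambda f w).
Proof.
move=> [bY sY] bf; split; first by apply: bmeasM => //; exact: Lambda_integral_bmeas.
move=> i' a c h bh.
pose t := transp i' a c.
have cv1 := Rintegral_mean_cvg HLambda bf (bmeasM bY (system_bmeas bh)).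
have cv2 := Rintegral_mean_cvg HLambda bf (bmeasM bY (reindexed_system_bmeas t bh)).
transitivity (\int[P]_w (Lambda_integral Lambda f w * (Y w * h (system X w)))).
  by apply: eq_Rintegral => w _; ring.
transitivity (\int[P]_w (Lambda_integral Lambda f w * (Y w * h (reindex_system t (system X w)))));
  last by apply: eq_Rintegral => w _; ring.
apply: (cvg_unique _ cv1 _) => //.
apply: cvg_trans (near_eq_cvg _) cv2; exists (maxn a c) => // K /=.
rewrite geq_max => /andP[aK cK].
pose m x := mean (fun n => f (x i n)) K : R.
have bm : bmeas (m : borel SS -> R).
  apply: bmeasM; first exact: bmeas_cst.
  apply: (@bmeas_sum _ (borel SS) R _ _ (fun (j : 'I_K.+1) x => f (x i j))) => j.
  exact: system_space_coord_bmeas.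
have mt x : m (reindex_system t x) = m x.
  rewrite /m /reindex_system /t /transp; case: ifPn => // _.
  exact: (mean_swapn (fun n => f (x i n)) aK cK).
transitivity (\int[P]_w (Y w * (m (system X w) * h (system X w)))).
  rewrite (sY i' a c (fun x => m x * h x)); last exact: bmeasM.
  by apply: eq_Rintegral => w _; rewrite mt /m; ring.
by apply: eq_Rintegral => w _; rewrite /m; ring.
Qed.

(** Invariance of Y under the transposition of n and m replaces X_{n,i} by
    X_{m,i} for every m >= N, since g does not notice it. The expectations
    u_m of Y f(X_{m,i}) g(X) are therefore constant for m >= N, their means
    converge to that constant, and the mean of f(X_{m,i}) converges to the
    integral of f against Lambda_i. *)
Lemma transp_invariant_coord (Y : Omega -> R) i n (f : S i -> R) (g : borel SS -> R) N :
  transp_invariant X Y -> bcont f -> bmeas g ->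
  (forall m x, (N <= m)%N -> g (reindex_system (transp i n m) x) = g x) ->
  \int[P]_w (Y w * (f (X n i w) * g (system X w))) =
  \int[P]_w (Y w * Lambda_integral Lambda f w * g (system X w)).
Proof.
move=> [bY sY] bf bg gt.
pose Z w := Y w * g (system X w).
have bZ : bmeas Z by apply: bmeasM => //; exact: system_bmeas.
pose u m := \int[P]_w (f (X m i w) * Z w).
have un m : (N <= m)%N -> u m = u n.
  move=> Nm; transitivity (\int[P]_w (Y w * (f (X n i w) * g (system X w)))); last first.
    by apply: eq_Rintegral => w _; rewrite /Z; ring.
  rewrite (sY i n m (fun x => f (x i n) * g x)); last first.
    by apply: bmeasM => //; exact: system_space_coord_bmeas.
  apply: eq_Rintegral => w _; rewrite gt// /reindex_system /transp eqxx swapnl.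
  by rewrite /Z /system; ring.
have mu K : mean u K = \int[P]_w (mean (fun n => f (X n i w)) K * Z w).
  rewrite /mean /u -Rintegral_sum_bmeas; last first.
    by move=> j; exact: bmeasM (coord_bmeas X j bf) bZ.
  rewrite -RintegralZ_bmeas; last first.
    by apply: bmeas_sum => j; exact: bmeasM (coord_bmeas X j bf) bZ.
  by apply: eq_Rintegral => w _; rewrite -mulrA mulr_suml.
transitivity (u n); first by apply: eq_Rintegral => w _; rewrite /Z; ring.
transitivity (\int[P]_w (Lambda_integral Lambda f w * Z w)); last first.
  by apply: eq_Rintegral => w _; rewrite /Z; ring.
apply: (cvg_unique _ (mean_cvg_eventually un)) => //.
rewrite (_ : mean u = fun K => \int[P]_w (mean (fun n => f (X n i w)) K * Z w)).
  exact: (Rintegral_mean_cvg HLambda bf bZ).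
by apply/funext.
Qed.

(** Coordinates are replaced one at a time. The factor that a replacement
    produces is absorbed into Y, which is why the statement is proved for all
    invariant Y and not only for indicators of exchangeable events. *)
Lemma transp_invariant_product (F : forall i, nat -> S i -> R) (s : seq ('I_C * nat))
    (Y : Omega -> R) : (forall i n, bcont (F i n)) -> uniq s -> transp_invariant X Y ->
  \int[P]_w (Y w * \prod_(p <- s) F p.1 p.2 (X p.2 p.1 w)) =
  \int[P]_w (Y w * \prod_(p <- s) Lambda_integral Lambda (F p.1 p.2) w).
Proof.
move=> bF; elim: s Y => [|[i n] s IH] Y.
  by move=> _ _; apply: eq_Rintegral => w _; rewrite !big_nil.
move=> /= /andP[ins us] sY.
transitivity (\int[P]_w (Y w * Lambda_integral Lambda (F i n) w *
    \prod_(p <- s) Lambda_integral Lambda (F p.1 p.2) w)); last first.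
  by apply: eq_Rintegral => w _; rewrite big_cons mulrA.
rewrite -(IH (fun w => Y w * Lambda_integral Lambda (F i n) w)) //;
  last exact: transp_invariant_Lambda_integral.
(* The bound exceeds all row indices occurring in s, so exchanging row n with a
   row beyond it leaves the remaining factors alone. *)
rewrite -(transp_invariant_coord (n := n) (g := fun x => \prod_(p <- s) F p.1 p.2 (x p.1 p.2))
  (N := \max_(p <- s) p.2.+1) sY (bF i n)).
- by apply: eq_Rintegral => w _; rewrite big_cons.
- by apply: bmeas_prod => p; exact: system_space_coord_bmeas.
move=> m x Nm; apply: eq_big_seq => -[j k] jks /=.
rewrite /reindex_system /transp; case: ifPn => // /eqP ji; subst j.
rewrite swapn_id//; first by apply: contraNneq ins => <-.
by rewrite ltn_eqF// (leq_trans _ Nm)//; exact: (leq_bigmax_seq (F := fun p => p.2.+1) (i, k)).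
Qed.

End product_formula.

(** * Equality of sigma-algebras up to null sets *)

Section almost_sure_equality.
Context d (Omega : measurableType d) (R : realType) (P : probability Omega R).
Implicit Types (A B : set Omega) (G : set (set Omega)).

Definition ae_in G A := exists2 B, G B & P.-negligible (A `+` B).

Lemma sub_ae_in G : G `<=` ae_in G.
Proof. by move=> A GA; exists A => //; rewrite setYK; exact: negligible_set0. Qed.

Lemma negligible_setY_trans A B D : P.-negligible (A `+` B) ->
  P.-negligible (B `+` D) -> P.-negligible (A `+` D).
Proof.
move=> AB BD; apply: negligibleS (negligibleU AB BD) => w /=.
by have [] := pselect (B w); tauto.
Qed.

Lemma ae_in_sub F G A : (forall B, F B -> ae_in G B) -> ae_in F A -> ae_in G A.
Proof.
move=> FG [B FB AB]; have [D GD BD] := FG B FB.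
by exists D => //; exact: negligible_setY_trans BD.
Qed.

Lemma ae_in_sigma_algebra G : sigma_algebra setT G -> sigma_algebra setT (ae_in G).
Proof.
move=> [G0 GC GU]; split.
- exact: sub_ae_in.
- move=> A [B GB AB]; exists (setT `\` B); first exact: GC.
  apply: negligibleS AB => w /=.
  by have [] := pselect (A w); have [] := pselect (B w); tauto.
- move=> A GA; have /choice[B GB] : forall n, exists B, G B /\ P.-negligible (A n `+` B).
    by move=> n; have [B ? ?] := GA n; exists B.
  exists (\bigcup_n B n); first by apply: GU => n; exact: (GB n).1.
  have : P.-negligible (\bigcup_n (A n `+` B n)).
    by apply: negligible_bigcup => n; exact: (GB n).2.
  apply: negligibleS => w [[[n _ Anw] nB]|[[n _ Bnw] nA]]; exists n => //=.
    by left; split=> // Bnw; apply: nB; exists n.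
  by right; split=> // Anw; apply: nA; exists n.
Qed.

(** Borel-Cantelli: approximations of A with summable errors have a limit
    superior that differs from A by a null set. *)
Lemma ae_in_approx G A : sigma_algebra setT G -> G `<=` measurable ->
  measurable A ->
  (forall e : R, 0 < e -> exists2 B, G B & (P (A `+` B) <= e%:E)%E) ->
  ae_in G A.
Proof.
move=> sG mG mA approx.
have [G0 GC GU] := sG.
have e0 n : 0 < 1 / (2 ^ n.+1)%:R :> R by rewrite divr_gt0// ltr0n expn_gt0.
have /choice[B BP] : forall n, exists B,
    G B /\ (P (A `+` B) <= (1 / (2 ^ n.+1)%:R)%:E)%E.
  by move=> n; have [B ? ?] := approx _ (e0 n); exists B.
have mB n : measurable (B n) by apply: mG; exact: (BP n).1.
have mAB n : measurable (A `+` B n) by apply: measurableU; exact: measurableD.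
exists (lim_sup_set B).
  have GI (F : nat -> set Omega) : (forall n, G (F n)) -> G (\bigcap_n F n).
    move=> GF; rewrite -[X in G X]setCK -setTD; apply: (GC).
    by rewrite setC_bigcap; apply: GU => n; rewrite -setTD; exact: GC.
  apply: GI => n.
  rewrite (_ : \bigcup_(j in _) _ = \bigcup_j B (n + j)%N).
    by apply: GU => j; exact: (BP _).1.
  apply/seteqP; split => w [j /= nj Bw]; last by exists (n + j)%N; rewrite //= leq_addr.
  by exists (j - n)%N; rewrite //= subnKC.
have N0 : P (lim_sup_set (fun n => A `+` B n)) = 0%E.
  apply: lim_sup_set_cvg0 => //.
  apply: (@le_lt_trans _ _ (\sum_(n <oo) (1 / (2 ^ n.+1)%:R : R)%:E)%E).
    by apply: lee_nneseries => n _ //; exact: (BP n).2.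
  exact: le_lt_trans (epsilon_trick0 _ ler01) (ltry _).
have : P.-negligible (lim_sup_set (fun n => A `+` B n)).
  apply/negligibleP => //; apply: bigcapT_measurable => n.
  exact: bigcup_measurable.
apply: negligibleS => w [[Aw nlim]|[limB nA]] n _; last first.
  by have [j nj Bj] := limB n I; exists j => //; right.
have [m mB'] : exists m, forall j, (m <= j)%N -> ~ B j w.
  apply: contrapT => h; apply: nlim => m _; apply: contrapT => h'.
  by apply: h; exists m => j mj Bj; apply: h'; exists j.
exists (maxn m n); first by rewrite /= leq_maxr.
by left; split => //; apply: mB'; rewrite leq_maxl.
Qed.

End almost_sure_equality.

(** * Tail events and exchangeable events *)

Section generated_sigma_algebra.
Context d (Omega : measurableType d) (R : realType) (P : probability Omega R).
Variables (I : Type) (J : set I) (T : I -> ptopologicalType).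
Variable F : forall i, {RV P >-> borel (T i)}.

Definition sigma_of_generators : set (set Omega) :=
  \bigcup_(j in J) preimage_set_system setT (F j) measurable.

Lemma sigma_of_sigma_algebra : sigma_algebra setT (sigma_of J F).
Proof. exact: smallest_sigma_algebra. Qed.

Lemma sigma_of_preimage j (B : set (borel (T j))) : J j -> measurable B ->
  sigma_of J F (F j @^-1` B).
Proof.
by move=> Jj mB; apply: sub_sigma_algebra; exists j => //; exists B; rewrite ?setTI.
Qed.

Lemma sigma_of_measurable_fun j : J j -> measurable_fun setT
  (F j : g_sigma_algebraType sigma_of_generators -> borel (T j)).
Proof. by move=> Jj _ B mB; rewrite setTI; exact: sigma_of_preimage. Qed.

Lemma sigma_of_sub_measurable : sigma_of J F `<=` measurable.
Proof.
apply: smallest_sub; first exact: sigma_algebra_measurable.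
move=> _ [j _ [B mB <-]]; exact: measurable_funPT.
Qed.

End generated_sigma_algebra.

Section sigma_of_monotone.
Context d (Omega : measurableType d) (R : realType) (P : probability Omega R).
Variables (I : Type) (J K : set I) (T : I -> ptopologicalType).
Variable F : forall i, {RV P >-> borel (T i)}.

Lemma sigma_ofS : J `<=` K -> sigma_of J F `<=` sigma_of K F.
Proof.
move=> JK; apply: smallest_sub; first exact: sigma_of_sigma_algebra.
move=> _ [j Jj [B mB <-]]; rewrite setTI; apply: sigma_of_preimage => //.
exact: JK.
Qed.

End sigma_of_monotone.

Section tail_and_exchangeable.
Context d (Omega : measurableType d) (R : realType) (P : probability Omega R).
Variables (C : nat) (S : 'I_C -> ptopologicalType).
Variable X : nat -> forall i : 'I_C, {RV P >-> borel (S i)}.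
Local Notation SS := (system_space S).

Lemma bigcap_sigma_algebra (I : Type) (D : set I) (G : I -> set (set Omega)) :
  (forall i, D i -> sigma_algebra setT (G i)) ->
  sigma_algebra setT (\bigcap_(i in D) G i).
Proof.
move=> sG; split.
- by move=> i Di; case: (sG i Di).
- by move=> A GA i Di; have [_ GC _] := sG i Di; exact/GC/GA.
- move=> A GA i Di; have [_ _ GU] := sG i Di; apply: GU => n; exact: GA.
Qed.

Lemma tail_sigma_sigma_algebra : sigma_algebra setT (tail_sigma X).
Proof. by apply: bigcap_sigma_algebra => k _; exact: sigma_of_sigma_algebra. Qed.

Lemma exch_sigma_k_sigma_algebra k : sigma_algebra setT (exch_sigma_k X k).
Proof.
split.
- by exists set0; rewrite ?preimage_set0//; split.
- move=> _ [B [mB kB] <-]; exists (~` B); last by rewrite setTD preimage_setC.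
  split; first exact: measurableC.
  by move=> s bs ks x; have := kB s bs ks x; rewrite /setC /=; tauto.
- move=> A eA; have /choice[B BP] : forall n, exists B : set (borel SS),
      (measurable B /\ k_multi_exchangeable k B) /\ system X @^-1` B = A n.
    by move=> n; have [B ? ?] := eA n; exists B.
  exists (\bigcup_n B n).
    split; first by apply: bigcupT_measurable => n; exact: (BP n).1.1.
    move=> s bs ks x; split=> -[n _ Bn]; exists n => //;
      exact/((BP n).1.2 s bs ks x).
  by rewrite preimage_bigcup; apply: eq_bigcupr => n _; exact: (BP n).2.
Qed.

Lemma exch_sigma_sigma_algebra : sigma_algebra setT (exch_sigma X).
Proof. by apply: bigcap_sigma_algebra => k _; exact: exch_sigma_k_sigma_algebra. Qed.

Lemma tail_sigma_sub_sigma_of :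
  tail_sigma X `<=` sigma_of setT (fun p : nat * 'I_C => X p.1 p.2).
Proof. by move=> A /(_ 1%N (ltn0Sn 0)); exact: sigma_ofS. Qed.

(** An event that only depends on the rows of index at least k is invariant
    under permutations of the rows below k. *)
Lemma tail_sub_exch : tail_sigma X `<=` exch_sigma X.
Proof.
move=> A tA k k0; have := tA k.+1 (ltn0Sn _); move: A {tA}.
apply: smallest_sub; first exact: exch_sigma_k_sigma_algebra.
move=> _ [[n i] /= kn [B mB <-]]; rewrite setTI.
exists [set x : SS | B (x i n)] => //; split.
  rewrite -[X in measurable X]setTI.
  exact: (@system_coord_measurable C S i n measurableT B mB).
by move=> s _ ks x /=; rewrite ks.
Qed.

End tail_and_exchangeable.

(** * Strict inequalities for the limit of means, as tail events *)

Section eventually_mean.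
Variables (R : realType) (r : R).

(** For a convergent sequence of means this says that the limit exceeds r
    strictly, but it makes sense without convergence and uses only countable
    operations; the event it defines can thus be compared exactly, and not
    just almost surely, for two sequences that differ in finitely many terms. *)
Definition mean_eventually_above (u : nat -> R) : Prop :=
  exists m N, forall K, (N <= K)%N -> r + m.+1%:R^-1 <= mean u K.

Lemma mean_eventually_aboveP (u : nat -> R) l : mean u @ \oo --> l ->
  mean_eventually_above u <-> r < l.
Proof.
move=> ul; split.
  move=> [m [N uN]]; apply: (@lt_le_trans _ _ (r + m.+1%:R^-1)).
    by rewrite ltrDl invr_gt0.
  rewrite leNgt; apply/negP => lr.
  have /cvgr_lt /(_ _ lr)[M _ uM] := ul.
  have := uN (maxn M N) (leq_maxr _ _).
  by rewrite leNgt (uM (maxn M N))//= leq_maxl.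
move=> rl.
pose m := Num.bound (l - r)^-1.
have mr : m.+1%:R^-1 < l - r.
  rewrite -[ltRHS]invrK ltf_pV2 ?posrE ?invr_gt0 ?subr_gt0//.
  apply: (lt_le_trans (archi_boundP _)); first by rewrite invr_ge0 subr_ge0 ltW.
  by rewrite ler_nat.
have /cvgr_gt /(_ (r + m.+1%:R^-1)) := ul.
rewrite -ltrBrDl mr => /(_ isT)[N _ uN]; exists m, N => K NK.
exact/ltW/uN.
Qed.

(** The means of u and v differ by a sequence tending to 0, which the gap
    between 1/(m+1) and 1/(m+2) absorbs. *)
Lemma mean_eventually_above_tail (u v : nat -> R) k :
  (forall n, (k <= n)%N -> u n = v n) ->
  mean_eventually_above u -> mean_eventually_above v.
Proof.
move=> uv [m [N uN]].
have : mean (fun n => v n - u n) @ \oo --> (0 : R).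
  by apply: (@mean_cvg_eventually _ _ _ k) => n kn; rewrite uv// subrr.
have m0 : 0 < m.+1%:R^-1 - m.+2%:R^-1 :> R.
  by rewrite subr_gt0 ltf_pV2 ?posrE ?ltr0n// ltr_nat.
move=> /cvgrPdist_lt /(_ _ m0)[M _ vM].
exists m.+1, (maxn M N) => K; rewrite geq_max => /andP[MK NK].
have := vM K MK; rewrite sub0r normrN ltr_norml => /andP[+ _].
rewrite /mean sumrB mulrBr -/(mean u K) -/(mean v K).
move: (uN K NK); move: (mean u K) (mean v K) (m.+1%:R^-1) (m.+2%:R^-1).
by move=> x y p q; lra.
Qed.

Lemma measurable_mean_eventually_above d (T : measurableType d)
    (u : nat -> T -> R) : (forall n, measurable_fun setT (u n)) ->
  measurable [set w | mean_eventually_above (u^~ w)].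
Proof.
move=> mu.
rewrite (_ : mkset _ = \bigcup_m \bigcup_N \bigcap_(K in [set K | (N <= K)%N])
   ((fun w => mean (u^~ w) K) @^-1` `[r + m.+1%:R^-1, +oo[%classic)).
  apply: bigcupT_measurable => m; apply: bigcupT_measurable => N.
  apply: bigcap_measurable => [|K _]; first by exists N => /=.
  rewrite -[X in measurable X]setTI.
  apply: measurable_funM => //.
  apply: (@measurable_sum _ _ R setT _ (index_enum 'I_K.+1) (fun j w => u j w)).
  by move=> j; exact: mu.
apply/seteqP; split => w /=.
  move=> [m [N uN]]; exists m => //; exists N => // K NK /=.
  by rewrite in_itv /= andbT; exact: uN.
move=> [m _ [N _ uN]]; exists m, N => K NK.
by have := uN K NK; rewrite /= in_itv /= andbT.
Qed.

End eventually_mean.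

(** * The directing measures are almost surely tail measurable *)

Section directing_measure_tail.
Context d (Omega : measurableType d) (R : realType) (P : probability Omega R).
Variables (C : nat) (S : 'I_C -> ptopologicalType).
Variables (b : forall i, nat -> S i -> R) (bb : forall i, bump_family (@b i)).
Variable X : nat -> forall i : 'I_C, {RV P >-> borel (S i)}.
Variable Lambda : forall i : 'I_C, {RV P >-> borel (prob_space R (S i))}.
Hypothesis HLambda : forall i, is_directing_measure (fun n => X n i) (Lambda i).

(** The witness is the event that the empirical means of f stay eventually
    above some level greater than r. It belongs to the k-th tail
    sigma-algebra for every k because replacing the terms of index less than
    k by 0 does not change it. *)
Lemma Lambda_integral_tail i (f : S i -> R) r : bcont f ->
  ae_in P (tail_sigma X) [set w | r < Lambda_integral Lambda f w].
Proof.
move=> bf; exists [set w | mean_eventually_above r (fun n => f (X n i w))].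
  move=> k k0.
  pose v n w := if (n < k)%N then 0 else f (X n i w).
  rewrite (_ : mkset _ = [set w | mean_eventually_above r (v^~ w)]); last first.
    apply/seteqP; split => w; apply: (@mean_eventually_above_tail _ _ _ _ k) => n kn.
      by rewrite /v ltnNge kn.
    by rewrite /v ltnNge kn.
  apply: (@measurable_mean_eventually_above R r _ (g_sigma_algebraType
    (sigma_of_generators [set p : nat * 'I_C | (k <= p.1.+1)%N] (fun p => X p.1 p.2))) v) => n.
  rewrite /v; case: ltnP => kn; first exact: measurable_cst.
  apply: (measurableT_comp (continuous_borel bf.1)).
  apply: (@sigma_of_measurable_fun _ _ _ P _ _ _ (fun p => X p.1 p.2) (n, i)).
  exact: leqW.
apply: negligibleS (mean_cvg_Lambda_integral HLambda bf) => w /=.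
move=> h /(mean_eventually_aboveP r); tauto.
Qed.

(** The events almost surely equal to a tail event form a sigma-algebra, for
    which Lambda_i is measurable as soon as the preimages of the countable
    subbase of the weak topology are in it. *)
Lemma sigma_Lambda_tail A : sigma_of setT Lambda A -> ae_in P (tail_sigma X) A.
Proof.
have sT := ae_in_sigma_algebra P (tail_sigma_sigma_algebra X).
move: A; apply: smallest_sub => // _ [i _ [U mU <-]]; rewrite setTI.
have mT : (ae_in P (tail_sigma X)).-sigma.-measurable = ae_in P (tail_sigma X).
  exact: measurable_g_measurableTypeE.
have : measurable_fun setT (Lambda i :
    g_sigma_algebraType (ae_in P (tail_sigma X)) -> borel (prob_space R (S i))).
  apply: (measurability _ (erefl : @measurable _ (borel (prob_space R (S i))) =
    <<s @open (prob_space R (S i)) >>)).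
  move=> _ [V oV <-]; rewrite setTI.
  apply: (measurable_preimage_open (weak_subbaseP (bb i))) => // -[s r].
  by rewrite mT; exact: (Lambda_integral_tail _ (tent_bcont (bb i) s)).
by move=> /(_ measurableT U mU); rewrite setTI mT.
Qed.

End directing_measure_tail.

(** * Exchangeable events are almost surely functions of the directing measures *)

Lemma fine_leE (R : realType) (x : \bar R) (r : R) : x \is a fin_num ->
  fine x <= r -> (x <= r%:E)%E.
Proof. by move=> xfin xr; rewrite -(fineK xfin) lee_fin. Qed.

Section exchangeable_sub_directing.
Context d (Omega : measurableType d) (R : realType) (P : probability Omega R).
Variables (C : nat) (S : 'I_C -> ptopologicalType).
Variables (b : forall i, nat -> S i -> R) (bb : forall i, bump_family (@b i)).
Variable X : nat -> forall i : 'I_C, {RV P >-> borel (S i)}.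
Hypothesis HX : multi_exchangeable X.
Variable Lambda : forall i : 'I_C, {RV P >-> borel (prob_space R (S i))}.
Hypothesis HLambda : forall i, is_directing_measure (fun n => X n i) (Lambda i).
Local Notation SS := (system_space S).

(** Test events are taken up to null sets so that they can be combined with
    sigma(Lambda)-measurable events, which are exchangeable only almost
    surely. *)
Definition exch_ae : set (set Omega) :=
  [set A | measurable A /\ ae_in P (exch_sigma X) A].

Lemma transp_invariant_exch_ae A : exch_ae A -> transp_invariant X (\1_A).
Proof.
move=> [mA [B eB AB]].
have mB := exch_sigma_measurable bb eB.
split; first exact: bmeas_indic.
have e (g : Omega -> R) : bmeas g ->
    \int[P]_w (\1_A w * g w) = \int[P]_w (\1_B w * g w).
  move=> bg; apply: ae_eq_Rintegral.
  - by case: (bmeasM (bmeas_indic R mA) bg).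
  - by case: (bmeasM (bmeas_indic R mB) bg).
  - apply: negligibleS AB => w /=; rewrite !indicE => h.
    have [wA|wA] := boolP (w \in A); have [wB|wB] := boolP (w \in B).
    + by exfalso; apply: h; rewrite wA wB.
    + by left; split; [exact/set_mem|move/mem_set; exact/negP].
    + by right; split; [exact/set_mem|move/mem_set; exact/negP].
    + by exfalso; apply: h; rewrite (negbTE wA) (negbTE wB).
move=> i a c h bh.
rewrite (e _ (system_bmeas bb X bh)) (e _ (reindexed_system_bmeas bb X _ bh)).
by have [_] := transp_invariant_exch bb HX eB; apply.
Qed.

(** This is the existence of a sigma(Lambda)-measurable conditional expectation
    of h given the exchangeable sigma-algebra, up to e. Asking for an
    approximation for each e makes the property closed under bounded limits
    without any choice of, or comparison between, successive phi. *)
Definition Lambda_approx (h : Omega -> R) := forall e : R, 0 < e ->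
  exists2 phi : Omega -> R,
    bmeas (phi : g_sigma_algebraType (sigma_of_generators setT Lambda) -> R) &
    forall A, exch_ae A ->
      `|\int[P]_w (\1_A w * h w) - \int[P]_w (\1_A w * phi w)| <= e.

Lemma bmeas_sigma_Lambda (phi : Omega -> R) :
  bmeas (phi : g_sigma_algebraType (sigma_of_generators setT Lambda) -> R) -> bmeas phi.
Proof. by apply: bmeas_sub; exact: (@sigma_of_sub_measurable _ _ _ P _ setT _ Lambda). Qed.

(** An error that is small in mean remains small after multiplication by the
    indicator of any test event, uniformly. *)
Lemma Lambda_approx_limit (h_ : nat -> Omega -> R) h M :
  (forall n, bmeas (h_ n)) -> bmeas h -> (forall n w, `|h_ n w| <= M) ->
  (forall w, h_ n w @[n --> \oo] --> h w) ->
  (forall n, Lambda_approx (h_ n)) -> Lambda_approx h.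
Proof.
move=> bh_ bh hM hh ah e e0; have e2 : 0 < e / 2 by rewrite divr_gt0.
have [_ [N hN]] := bh.
have bD n : bmeas (fun w => `|h w - h_ n w|) by apply: bmeas_norm; exact: bmeasB.
have : \int[P]_w `|h w - h_ n w| @[n --> \oo] --> \int[P]_w (0 : R).
  apply: (@bounded_convergence _ _ _ P _ _ (N + M)).
  - by move=> n; case: (bD n).
  - exact: measurable_cst.
  - by move=> n w; rewrite normr_id (le_trans (ler_normB _ _))// lerD.
  - apply: aeW => w; rewrite -(@normr0 _ R); apply: cvg_norm.
    by rewrite -(subrr (h w)); apply: cvgB; [exact: cvg_cst|exact: hh].
rewrite Rintegral_prob_cst => /cvgr_lt /(_ _ e2)[n _ /(_ n (leqnn n)) /= hn].
have [phi bphi phiA] := ah n _ e2.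
have bphi' := bmeas_sigma_Lambda bphi.
exists phi => // A eA; have b1 := bmeas_indic R eA.1.
rewrite -(subrKA (\int[P]_w (\1_A w * h_ n w))) (le_trans (ler_normD _ _))//.
rewrite [leRHS]splitr; apply: lerD; last exact: phiA.
rewrite -RintegralB_bmeas; [|exact: bmeasM|exact: bmeasM].
apply: le_trans (ltW hn).
apply: (le_trans (le_normr_Rintegral measurableT _)).
  by apply: bmeas_integrable; apply: bmeasB; exact: bmeasM.
apply: le_Rintegral_bmeas => //.
  by apply: bmeas_norm; apply: bmeasB; exact: bmeasM.
move=> w; rewrite -mulrBr normrM ler_piMl// indicE.
by case: (_ \in _); rewrite ?normr1 ?normr0.
Qed.

(** Here the approximation is exact, by [transp_invariant_product]. *)
Lemma Lambda_approx_product (F : forall i, nat -> S i -> R) s :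
  (forall i n, bcont (F i n)) -> uniq s ->
  Lambda_approx (fun w => \prod_(p <- s) F p.1 p.2 (X p.2 p.1 w)).
Proof.
move=> bF us e e0.
exists (fun w => \prod_(p <- s) Lambda_integral Lambda (F p.1 p.2) w).
  apply: (@bmeas_prod _ (g_sigma_algebraType (sigma_of_generators setT Lambda))) => p.
  apply: integral_kernel_bmeas => //.
  exact: (@sigma_of_measurable_fun _ _ _ P _ _ _ Lambda).
move=> A eA; rewrite (transp_invariant_product bb HLambda bF us (transp_invariant_exch_ae eA)).
by rewrite subrr normr0 ltW.
Qed.

Lemma min_natmul_cvg (a : R) : 0 <= a ->
  Num.min 1 (m%:R * a) @[m --> \oo] --> ((0 < a)%R%:R : R).
Proof.
rewrite le_eqVlt => /predU1P[<-|a0].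
  by rewrite ltxx; under eq_fun do rewrite mulr0 (min_idPr ler01); exact: cvg_cst.
rewrite a0; apply: cvg_near_cst.
exists (Num.bound a^-1) => // m /= am.
apply/min_idPl; rewrite -ler_pdivrMr// mul1r.
apply: (le_trans (ltW (archi_boundP _))); first by rewrite invr_ge0 ltW.
by rewrite ler_nat.
Qed.

Lemma cvg_prod_seq (I : Type) (s : seq I) (u : nat -> I -> R) (l : I -> R) :
  (forall i, u m i @[m --> \oo] --> l i) ->
  \prod_(i <- s) u m i @[m --> \oo] --> \prod_(i <- s) l i.
Proof.
move=> ul; elim: s => [|i s IH].
  by under eq_fun do rewrite big_nil; rewrite big_nil; exact: cvg_cst.
under eq_fun do rewrite big_cons.
by rewrite big_cons; apply: cvgM; [exact: ul|exact: IH].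
Qed.

(** The indicator of {f > 0} is the limit of the continuous functions min(1, m f). *)
Lemma Lambda_approx_box (f : forall i, nat -> S i -> R) : box_test f ->
  Lambda_approx (\1_(system X @^-1` box f)).
Proof.
move=> tf; have [cf f01 [N fN]] := tf.
pose s := [seq (i, n) | i <- enum 'I_C, n <- iota 0 N].
have us : uniq s.
  by apply: allpairs_uniq => [||[? ?] [? ?]//]; [exact: enum_uniq|exact: iota_uniq].
pose F m i n y := Num.min 1 (m%:R * f i n y) : R.
have F01 m i n y : 0 <= F m i n y <= 1.
  have /andP[f0 _] := f01 i n y.
  by rewrite /F le_min ler01 mulr_ge0//= ge_min lexx.
have bF m i n : bcont (F m i n).
  split; last first.
    exists 1 => y; have /andP[F0 F1] := F01 m i n y; by rewrite ger0_norm.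
  move=> y; apply: (@continuous_min R _ (fun=> 1) (fun y => m%:R * f i n y)).
    exact: cvg_cst.
  by apply: cvgM; [exact: cvg_cst|exact: cf].
have mbox : measurable (system X @^-1` box f).
  rewrite -[X in measurable X]setTI.
  exact: (system_measurable bb X measurableT (box_measurable tf)).
apply: (@Lambda_approx_limit
  (fun m w => \prod_(p <- s) F m p.1 p.2 (X p.2 p.1 w)) _ 1).
- by move=> m; apply: bmeas_prod => p; exact: coord_bmeas.
- exact: bmeas_indic.
- move=> m w; elim: s {us} => [|p s IH]; first by rewrite big_nil normr1.
  rewrite big_cons normrM mulr_ile1//.
  by have /andP[F0 F1] := F01 m p.1 p.2 (X p.2 p.1 w); rewrite ger0_norm.
- move=> w.
  rewrite (_ : \1__ _ = \prod_(p <- s) (0 < f p.1 p.2 (X p.2 p.1 w))%R%:R).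
    apply: cvg_prod_seq => p; apply: min_natmul_cvg.
    by have /andP[] := f01 p.1 p.2 (X p.2 p.1 w).
  rewrite indicE; have [fw|/negP fw] := boolP (w \in _).
    rewrite big1// => p _; move/set_mem: fw => /(_ p.1 p.2) fw.
    by rewrite fw.
  have [i [n fin]] : exists i n, ~ 0 < f i n (X n i w).
    apply: contrapT => h; apply/fw/mem_set => i n; apply: contrapT => h'.
    by apply: h; exists i, n.
  have nN : (n < N)%N.
    by rewrite ltnNge; apply/negP => /(fN i) fE; apply: fin; rewrite fE.
  have ins : (i, n) \in s by apply: allpairs_f; rewrite ?mem_enum// mem_iota.
  by rewrite (big_rem _ ins) /= (negbTE (introN idP fin)) mul0r.
- by move=> m; exact: Lambda_approx_product.
Qed.

Lemma Lambda_approx_system (B : set (borel SS)) : measurable B ->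
  Lambda_approx (\1_(system X @^-1` B)).
Proof.
move: B.
pose H := [set B : set (borel SS) | measurable B /\
  Lambda_approx (\1_(system X @^-1` B))].
have mX (E : set (borel SS)) : measurable E -> measurable (system X @^-1` E).
  move=> mE; rewrite -[X in measurable X]setTI.
  exact: (system_measurable bb X measurableT mE).
suff HH : <<s @boxes R C S >> `<=` H.
  by move=> B; rewrite (borel_boxes bb) => /HH[].
apply: lambda_system_subset => //.
- exact: boxesI.
- split => //.
  + split => //; rewrite preimage_setT => e e0; exists (fun=> 1).
      exact: bmeas_cst.
    move=> A eA; rewrite (_ : \1_setT = fun=> 1) ?subrr ?normr0 ?ltW//.
    by apply/funext => w; rewrite indicE in_setT.
  + move=> B B' B'B [mB aB] [mB' aB']; split; first exact: measurableD.
    move=> e e0; have e2 : 0 < e / 2 by rewrite divr_gt0.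
    have [phi bphi phiA] := aB _ e2; have [psi bpsi psiA] := aB' _ e2.
    exists (fun w => phi w - psi w); first exact: bmeasB.
    move=> A eA; have b1 := bmeas_indic R eA.1.
    have b2 := bmeas_indic R (mX _ mB); have b3 := bmeas_indic R (mX _ mB').
    have bphi' := bmeas_sigma_Lambda bphi; have bpsi' := bmeas_sigma_Lambda bpsi.
    rewrite [X in `|X - _|](_ : _ = \int[P]_w (\1_A w * \1_(system X @^-1` B) w) -
        \int[P]_w (\1_A w * \1_(system X @^-1` B') w)); last first.
      rewrite -RintegralB_bmeas; [|exact: bmeasM|exact: bmeasM].
      apply: eq_Rintegral => w _; rewrite -mulrBr; congr (_ * _).
      rewrite (_ : _ @^-1` (B `\` B') = system X @^-1` B `\` system X @^-1` B')//.
      rewrite !indicE in_setD.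
      have [wB'|_] := boolP (w \in system X @^-1` B'); last by rewrite andbT subr0.
      rewrite (_ : w \in _ @^-1` B = true) ?subrr//.
      by apply/mem_set; apply: B'B; exact: set_mem wB'.
    rewrite [X in `|_ - X|](_ : _ = \int[P]_w (\1_A w * phi w) -
        \int[P]_w (\1_A w * psi w)); last first.
      rewrite -RintegralB_bmeas; [|exact: bmeasM|exact: bmeasM].
      by apply: eq_Rintegral => w _; rewrite -mulrBr.
    have := phiA _ eA; have := psiA _ eA; rewrite !ler_norml.
    by move=> /andP[? ?] /andP[? ?]; apply/andP; split; lra.
  + move=> B ndB HB; split; first by apply: bigcupT_measurable => n; exact: (HB n).1.
    apply: (@Lambda_approx_limit (fun n => \1_(system X @^-1` B n)) _ 1).
    * by move=> n; apply: bmeas_indic; apply: mX; exact: (HB n).1.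
    * apply: bmeas_indic; apply: mX; apply: bigcupT_measurable => n; exact: (HB n).1.
    * by move=> n w; rewrite indicE; case: (_ \in _); rewrite ?normr1 ?normr0.
    * move=> w; rewrite [in X in _ --> X]indicE.
      have [/set_mem[n _ Bn]|wB] := boolP (w \in _).
        apply: cvg_near_cst; exists n => // m nm; rewrite indicE mem_set//.
        by have /subsetPset := ndB _ _ nm; apply.
      apply: cvg_near_cst; apply: nearW => m; rewrite indicE memNset// => Bm.
      by move/negP: wB; apply; apply/mem_set; exists m.
    * by move=> n; exact: (HB n).2.
- move=> _ [f tf <-]; split; first exact: box_measurable.
  exact: Lambda_approx_box.
Qed.

(** For phi approximating 1_A, the event {phi > 1/2} is close to A: on
    A minus {phi > 1/2} the difference 1_A - phi is at least 1/2, on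
    {phi > 1/2} minus A it is less than -1/2, and both sets are admissible
    test events. *)
Lemma exch_sub_sigma_Lambda A : exch_sigma X A -> ae_in P (sigma_of setT Lambda) A.
Proof.
move=> eA; have mA := exch_sigma_measurable bb eA.
apply: ae_in_approx => //.
- exact: sigma_of_sigma_algebra.
- exact: sigma_of_sub_measurable.
(* Each of the two differences has probability at most twice the error of phi. *)
move=> e e0; have e4 : 0 < e / 4 by rewrite divr_gt0.
have [D [mD _] DA] := eA 1%N (ltn0Sn 0).
have [phi bphi phiA] := Lambda_approx_system mD e4.
rewrite {}DA in phiA.
have bphi' := bmeas_sigma_Lambda bphi.
pose B := [set w | 2^-1 < phi w].
have sB : sigma_of setT Lambda B.
  have := bphi.1 measurableT `]2^-1, +oo[%classic (measurable_itv _).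
  rewrite setTI; congr (sigma_of _ _ _); apply/seteqP; split => w;
    by rewrite /B /= in_itv /= andbT.
have mB := sigma_of_sub_measurable sB.
have eB : ae_in P (exch_sigma X) B.
  apply: ae_in_sub (sigma_Lambda_tail bb HLambda sB) => E tE.
  exact/sub_ae_in/tail_sub_exch.
have mE : (ae_in P (exch_sigma X)).-sigma.-measurable = ae_in P (exch_sigma X).
  have sE := ae_in_sigma_algebra P (exch_sigma_sigma_algebra X).
  exact: measurable_g_measurableTypeE.
have eAB : exch_ae (A `\` B).
  split; first exact: measurableD.
  by rewrite -mE; apply: measurableD; rewrite mE//; exact: sub_ae_in.
have eBA : exch_ae (B `\` A).
  split; first exact: measurableD.
  by rewrite -mE; apply: measurableD; rewrite mE//; exact: sub_ae_in.
have b1 := bmeas_indic R eAB.1; have b2 := bmeas_indic R eBA.1.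
have h1 : fine (P (A `\` B)) <= e / 2.
  rewrite -Rintegral_indic_prob; last exact: measurableD.
  have : \int[P]_w (\1_(A `\` B) w * phi w) <=
      \int[P]_w (2^-1 * \1_(A `\` B) w).
    apply: le_Rintegral_bmeas; [exact: bmeasM|exact: bmeasM (bmeas_cst _ _) _|].
    move=> w; rewrite indicE; have [/set_mem[_ /negP]|_] := boolP (w \in _).
      by rewrite /B /= -leNgt mul1r mulr1.
    by rewrite mul0r mulr0.
  rewrite RintegralZ_bmeas//.
  have := phiA _ eAB.
  rewrite [X in `|X - _|](_ : _ = \int[P]_w \1_(A `\` B) w); last first.
    apply: eq_Rintegral => w _; rewrite !indicE in_setD.
    by case: (w \in A); rewrite ?mulr1 ?mul0r.
  by rewrite ler_norml => /andP[_]; lra.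
have h2 : fine (P (B `\` A)) <= e / 2.
  rewrite -Rintegral_indic_prob; last exact: measurableD.
  have : \int[P]_w (2^-1 * \1_(B `\` A) w) <=
      \int[P]_w (\1_(B `\` A) w * phi w).
    apply: le_Rintegral_bmeas; [exact: bmeasM (bmeas_cst _ _) _|exact: bmeasM|].
    move=> w; rewrite indicE; have [/set_mem[Bw _]|_] := boolP (w \in _).
      by rewrite mul1r mulr1 ltW.
    by rewrite mul0r mulr0.
  rewrite RintegralZ_bmeas//.
  have := phiA _ eBA.
  rewrite [X in `|X - _|](_ : _ = 0); last first.
    rewrite -[RHS](Rintegral_prob_cst P 0); apply: eq_Rintegral => w _.
    by rewrite !indicE in_setD; case: (w \in A); rewrite ?mulr0 ?andbF ?mul0r.
  by rewrite ler_norml => /andP[+ _]; lra.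
exists B => //; apply: (le_trans (measureU2 P (measurableD mA mB) (measurableD mB mA))).
rewrite [e]splitr EFinD; apply: leeD.
  by apply: (fine_leE _ h1); rewrite fin_num_measure//; exact: measurableD.
by apply: (fine_leE _ h2); rewrite fin_num_measure//; exact: measurableD.
Qed.

End exchangeable_sub_directing.

(** * Independence and Kolmogorov's argument *)

Section zero_one_law.
Context d (Omega : measurableType d) (R : realType) (P : probability Omega R).

(** Both sides are finite measures in A, the restriction of P to D and a
    multiple of P, so agreement on a generating pi-system is enough. *)
Lemma independent_sigma_algebra (G : set (set Omega)) (D : set Omega) :
  G `<=` measurable -> G setT -> setI_closed G -> measurable D ->
  (forall A, G A -> P (A `&` D) = (P A * P D)%E) ->
  forall A, <<s G >> A -> P (A `&` D) = (P A * P D)%E.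
Proof.
move=> mG GT GI mD GD A sA.
pose q : {nonneg R} := NngNum (fine_ge0 (measure_ge0 P D)).
have qE : (q%:num)%:E = P D by rewrite /= fineK// fin_num_measure.
suff : mrestr P mD A = mscale q P A by rewrite /mrestr /mscale qE muleC.
apply: (g_sigma_algebra_measure_unique G mG (fun=> setT)) => //.
- by rewrite bigcup_const.
- by move=> B GB; have := GD B GB; rewrite muleC -qE.
- move=> _; apply: (@le_lt_trans _ _ 1%E); last exact: ltry.
  exact: (@probability_le1 _ _ _ P (setT `&` D) (measurableI _ _ measurableT mD)).
Qed.

Lemma ae_eq_probability (A B : set Omega) : measurable A -> measurable B ->
  P.-negligible (A `+` B) -> P A = P B.
Proof.
move=> mA mB AB.
have mAB : measurable (A `+` B) by apply: measurableU; exact: measurableD.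
have P0 : P (A `+` B) = 0%E by apply/negligibleP.
have le (E F : set Omega) : measurable E -> measurable F -> E `<=` F `|` (A `+` B) ->
    (P E <= P F)%E.
  move=> mE mF EF; rewrite -[leRHS]adde0 -[in leRHS]P0.
  apply: le_trans (measureU2 P mF mAB).
  by apply: le_measure; rewrite ?inE//; exact: measurableU.
apply/eqP; rewrite eq_le !le//= => w.
  by have [] := pselect (A w); rewrite /setY /=; tauto.
by have [] := pselect (B w); rewrite /setY /=; tauto.
Qed.

Variables (I : choiceType) (T : I -> ptopologicalType).
Variable F : forall i, {RV P >-> borel (T i)}.

Definition finite_cylinder (K : {fset I}) (B : forall i, set (borel (T i))) :
  set Omega := \bigcap_(i in [set` K]) F i @^-1` B i.

Definition finite_cylinders (J : set I) : set (set Omega) :=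
  [set E | exists (K : {fset I}) (B : forall i, set (borel (T i))),
     [/\ [set` K] `<=` J, forall i, measurable (B i) & E = finite_cylinder K B]].

Lemma finite_cylinder_measurable K B : (forall i, measurable (B i)) ->
  measurable (finite_cylinder K B).
Proof.
move=> mB; apply: fin_bigcap_measurable => // i _.
by rewrite -[X in measurable X]setTI; exact: measurable_funPT.
Qed.

(** The families of sets are extended by the whole space outside their finite
    index sets before being intersected, so that one family over the union
    of the index sets describes the intersection. *)
Lemma finite_cylinders_setI J : setI_closed (finite_cylinders J).
Proof.
move=> _ _ [K [B [KJ mB ->]]] [K' [B' [KJ' mB' ->]]].
exists (K `|` K')%fset, (fun i => (if i \in K then B i else setT) `&`
  (if i \in K' then B' i else setT)).
split.
- by move=> i /=; rewrite inE => /orP[]; [exact: KJ|exact: KJ'].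
- by move=> i; apply: measurableI; case: ifPn.
apply/seteqP; split => w.
  move=> [h h'] i /= _; split; case: ifPn => // iK; [exact: h|exact: h'].
move=> h; split=> i /= iK; have := h i; rewrite /= inE iK ?orbT => /(_ isT)[] //.
Qed.

Lemma finite_cylinders_generate J : sigma_of J F `<=` <<s finite_cylinders J >>.
Proof.
apply: smallest_sub; first exact: smallest_sigma_algebra.
move=> _ [j Jj [B mB <-]]; apply: sub_sigma_algebra.
exists [fset j]%fset, (dfwith (fun i => setT : set (borel (T i))) j B); split.
- by move=> i /=; rewrite inE => /eqP ->.
- move=> i; have [<-|ji] := eqVneq j i; first by rewrite dfwithin.
  by rewrite dfwithout.
apply/seteqP; split => w.
  by move=> [_ Bw] i /=; rewrite inE => /eqP ->; rewrite dfwithin.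
by move=> /(_ j); rewrite /= inE eqxx dfwithin => /(_ isT).
Qed.

Hypothesis HF : mutually_independent F.

(** By [independent_sigma_algebra] it is enough to treat a cylinder over an
    index set K' disjoint from K; the intersection is then a cylinder over
    the union of K and K', and the product over the union splits. *)
Lemma cylinder_independent J (K : {fset I}) B A :
  (forall i, i \in K -> ~ J i) -> (forall i, measurable (B i)) ->
  sigma_of J F A ->
  P (A `&` finite_cylinder K B) = (P A * P (finite_cylinder K B))%E.
Proof.
move=> KJ mB /finite_cylinders_generate; move: A.
apply: independent_sigma_algebra.
- by move=> _ [K' [B' [_ mB' ->]]]; exact: finite_cylinder_measurable.
- exists fset0, (fun=> setT); split => //.
  by apply/seteqP; split => // w _ i.
- exact: finite_cylinders_setI.
- exact: finite_cylinder_measurable.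
move=> _ [K' [B' [KJ' mB' ->]]].
pose E i := if i \in K then B i else B' i.
have mE i : measurable (E i) by rewrite /E; case: ifPn.
have KK' i : i \in K' -> i \in K = false.
  by move=> iK'; apply/negbTE/negP => /KJ; apply; exact: KJ'.
have -> : finite_cylinder K' B' `&` finite_cylinder K B =
    finite_cylinder (K' `|` K)%fset E.
  apply/seteqP; split => w.
    move=> [h' h] i /=; rewrite inE /E.
    by have [iK _|_] := ifPn; [exact: h|rewrite orbF => iK'; exact: h'].
  move=> h; split => i /= iK; have := h i; rewrite /= inE iK ?orbT /E.
    by rewrite KK'// => /(_ isT).
  by rewrite iK => /(_ isT).
rewrite /finite_cylinder HF// HF// HF//.
rewrite (perm_big (K' ++ K)); last first.
  apply: uniq_perm; first exact: fset_uniq.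
    rewrite cat_uniq !fset_uniq /= andbT; apply/hasPn => i iK.
    by apply/negP => /KK'; rewrite iK.
  by move=> i; rewrite inE mem_cat.
rewrite big_cat /=; congr (_ * _)%E; apply: eq_big_seq => i iK; rewrite /E.
  by rewrite KK'.
by rewrite iK.
Qed.

End zero_one_law.

(** * The three sigma-algebras *)

Theorem theorem3p4 (d : measure_display) (Omega : measurableType d)
    (R : realType) (P : probability Omega R)
    (C : nat) (HC : (0 < C)%N)
    (S : 'I_C -> ptopologicalType) (HS : forall i, polish R (S i))
    (X : nat -> forall i : 'I_C, {RV P >-> borel (S i)})
    (HX : multi_exchangeable X)
    (Lambda : forall i : 'I_C, {RV P >-> borel (prob_space R (S i))})
    (HLambda : forall i, is_directing_measure (fun n => X n i) (Lambda i)) :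
  [/\ sigma_ae_eq P (sigma_of setT Lambda) (tail_sigma X),
      sigma_ae_eq P (tail_sigma X) (exch_sigma X)
    & mutually_independent (fun p : nat * 'I_C => X p.1 p.2) ->
      forall A : set Omega, exch_sigma X A -> P A = 0%E \/ P A = 1%E].
Proof.
have ex_bumps i : {b : nat -> S i -> R | bump_family b}.
  exact/cid/polish_bumps.
pose b i := sval (ex_bumps i).
have bb i : bump_family (b i) := svalP (ex_bumps i).
have exch_Lambda := exch_sub_sigma_Lambda bb HX HLambda.
have Lambda_tail := sigma_Lambda_tail bb HLambda.
have exch_tail A : exch_sigma X A -> ae_in P (tail_sigma X) A.
  by move=> /exch_Lambda; exact: ae_in_sub.
have swap F G : (forall A, G A -> ae_in P F A) ->
    forall B, G B -> exists2 A, F A & P.-negligible (A `+` B).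
  by move=> GF B /GF[A FA AB]; exists A => //; rewrite setYC.
split.
- by split=> //; apply: swap => A /tail_sub_exch; exact: exch_Lambda.
- split; last exact: swap.
  by move=> A /tail_sub_exch; exact: sub_ae_in.
move=> indep A eA; have [B tB AB] := exch_tail A eA.
have sB := tail_sigma_sub_sigma_of tB.
have mB := sigma_of_sub_measurable sB.
rewrite (ae_eq_probability (exch_sigma_measurable bb eA) mB AB).
have : P (B `&` B) = (P B * P B)%E.
  apply: (independent_sigma_algebra _ _ _ mB _ (finite_cylinders_generate sB)).
  - by move=> _ [K [E [_ mE ->]]]; exact: finite_cylinder_measurable.
  - exists fset0, (fun=> setT); split => //.
    by apply/seteqP; split => // w _ i.
  - exact: finite_cylinders_setI.
  - move=> _ [K [E [_ mE ->]]]; rewrite setIC muleC.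
    (* The k-th tail sigma-algebra only involves row indices above those of K. *)
    pose k := (\max_(p <- K) p.1).+2.
    apply: (cylinder_independent indep (J := [set p | (k <= p.1.+1)%N])) => //.
      move=> p pK /=; apply/negP; rewrite -ltnNge ltnS.
      exact: (leq_bigmax_seq (F := fun p : nat * 'I_C => p.1) p).
    exact: tB.
rewrite setIid -(fineK (fin_num_measure P B mB)) -EFinM => -[] /eqP.
rewrite -subr_eq0 -[X in X - _]mulr1 -mulrBr mulf_eq0 subr_eq0.
by move=> /orP[]/eqP => [->|<-]; [left|right].
Qed.
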